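(* Let $H$ be a semisimple Hopf algebra over an algebraically closed field $k$ of characteristic $0$, and let $T:Z(H)\to Z(H)$ be the operator $T(z)=\{z,\Lambda\}$. Then: (i) The matrix of $T$ with respect to the basis $\left\{\frac{E_0}{d_0^2},\dots,\frac{E_{n-1}}{d_{n-1}^2}\right\}$ of $Z(H)$ is the matrix $A=(A_{ij})$ given by $$A_{ij}=\frac{\langle\chi_i s(\chi_i)s(\chi_j),\Lambda\rangle}{d_j},\qquad 0\le i,j\le n-1 .$$ (ii) $A$ has non-negative rational entries, and the first column of $A$ (the column with index $j=0$) has all entries equal to $1$. (iii) The first row of $A^m$ (the row with index $0$) is $(1,0,\dots,0)$ for all $m\ge 0$. (iv) For the first column of $A^m$ one has $$(A^m)_{i0}=\sum_{j}(A^{m-1})_{ij}$$ for all $m>0$, $0\le i\le n-1$. In particular, the first column of $A^m$ ($m>0$) consists of positive rational numbers.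
   Context: Notation: $\Delta(h)=\sum h_1\otimes h_2$, $\varepsilon$, $S$ are the comultiplication, counit and antipode of $H$; $s$ is the antipode of the dual Hopf algebra $H^*$; $Z(H)$ is the center of $H$; $\Lambda$ is the idempotent integral of $H$; $\langle\,,\rangle$ is the evaluation pairing between $H^*$ and $H$. $V_0,\dots,V_{n-1}$ is a complete set of non-isomorphic irreducible $H$-modules, with associated central primitive idempotents $E_0,\dots,E_{n-1}$ and irreducible characters $\chi_0,\dots,\chi_{n-1}\in H^*$, where $E_0=\Lambda$ and $\chi_0=\varepsilon$; $d_i=\dim V_i=\langle\chi_i,1\rangle$. Products of characters are taken in $H^*$. For $a,b\in H$, $\{a,b\}=\sum a_1b_1S(a_2)S(b_2)$; it is known that $\{z,\Lambda\}\in Z(H)$ for $z\in Z(H)$. Matrix convention: the matrix of $T$ with respect to a basis $\{e_j\}$ is $(A_{ij})$ with $T(e_j)=\sum_iA_{ij}e_i$. *)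

(* Defs.v *)
From HB Require Import structures.
From mathcomp Require Import all_boot all_order all_algebra all_field.

Set Implicit Arguments.
Unset Strict Implicit.
Unset Printing Implicit Defensive.

Import GRing.Theory passmx.
Local Open Scope ring_scope.

(* [U] and [V] are given their canonical bases [vbasis fullv]; a tensor is
   the matrix of its coordinates in the product basis, and [tlift] is the
   map out of the tensor product given by its universal property ([tliftE],
   [tlift_unique]). *)

Section Tensor.
Context {k : fieldType}.
Implicit Types U V W : vectType k.

Definition tens U V : vectType k := 'M[k]_(\dim {:U}, \dim {:V}).

Definition pure {U V} (u : U) (v : V) : tens U V :=
  \matrix_(i, j) (coord (vbasis {:U}) i u * coord (vbasis {:V}) j v).

Definition tlift {U V W} (f : U -> V -> W) (t : tens U V) : W :=
  \sum_(i < \dim {:U}) \sum_(j < \dim {:V})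
    (t : 'M[k]_(_, _)) i j *: f (vbasis {:U})`_i (vbasis {:V})`_j.

Fact tlift_is_linear U V W (f : U -> V -> W) : linear (tlift f).
Proof.
move=> a s t; rewrite /tlift scaler_sumr -big_split; apply: eq_bigr => i _ /=.
rewrite scaler_sumr -big_split; apply: eq_bigr => j _ /=.
by rewrite !mxE scalerDl scalerA.
Qed.
HB.instance Definition _ U V W (f : U -> V -> W) :=
  GRing.isSemilinear.Build k (tens U V) W _ (tlift f)
    (GRing.semilinear_linear (tlift_is_linear f)).

Lemma tliftE U V W (f : U -> V -> W) :
    (forall v, linear (f^~ v)) -> (forall u, linear (f u)) ->
  forall u v, tlift f (pure u v) = f u v.
Proof.
move=> fl fr u v.
pose gl v := GRing.isLinear.Build k U W _ (f^~ v) (fl v).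
pose gr u := GRing.isLinear.Build k V W _ (f u) (fr u).
pose Gl v : {linear U -> W} := HB.pack (f^~ v) (gl v).
pose Gr u : {linear V -> W} := HB.pack (f u) (gr u).
rewrite {2}(coord_vbasis (memvf u)) -[RHS]/(Gl v _) linear_sum.
apply: eq_bigr => i _; rewrite linearZ /= -[f _ v]/(Gr _ v).
rewrite {2}(coord_vbasis (memvf v)) linear_sum scaler_sumr.
by apply: eq_bigr => j _; rewrite mxE linearZ scalerA.
Qed.

Lemma tlift_unique U V W (g : {linear tens U V -> W}) t :
  g t = tlift (fun u v => g (pure u v)) t.
Proof.
rewrite [t in LHS]matrix_sum_delta linear_sum; apply: eq_bigr => i _.
rewrite linear_sum; apply: eq_bigr => j _; rewrite linearZ; congr (_ *: g _).
apply/matrixP => p q; rewrite !mxE !coord_free ?(basis_free (vbasisP _)) //.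
by rewrite -natrM mulnb eq_sym [j == q]eq_sym.
Qed.

Definition tmap {U V U' V' : vectType k} (f : U -> U') (g : V -> V') :
    tens U V -> tens U' V' :=
  tlift (fun u v => pure (f u) (g v)).

Definition tassoc {U V W} : tens (tens U V) W -> tens U (tens V W) :=
  tlift (fun x w => tlift (fun u v => pure u (pure v w)) x).

Definition tmul {A B : falgType k} (s t : tens A B) : tens A B :=
  tlift (fun a b => tlift (fun c d => pure (a * c) (b * d)) t) s.

End Tensor.

(* A Hopf algebra that is semisimple as an algebra is finite-dimensional, so
   nothing is lost by building on [falgType]. *)
HB.mixin Record Falgebra_isHopf (k : fieldType) H of Falgebra k H := {
  comul : {linear H -> tens H H};
  counit : {linear H -> k^o};
  antipode : {linear H -> H};
  comulA : forall h : H,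
    tassoc (tmap comul (@id H) (comul h)) = tmap (@id H) comul (comul h);
  counitl : forall h : H, tlift (fun a b : H => counit a *: b) (comul h) = h;
  counitr : forall h : H, tlift (fun a b : H => counit b *: a) (comul h) = h;
  comul1 : comul 1 = pure 1 1;
  comulM : forall g h : H, comul (g * h) = tmul (comul g) (comul h);
  counit1 : counit 1 = 1;
  counitM : forall g h : H, counit (g * h) = counit g * counit h;
  antipodel : forall h : H,
    tlift (fun a b : H => antipode a * b) (comul h) = (counit h : k)%:A;
  antipoder : forall h : H,
    tlift (fun a b : H => a * antipode b) (comul h) = (counit h : k)%:A
}.

#[short(type="hopfAlgType")]
HB.structure Definition HopfAlgebra (k : fieldType) :=
  { H of Falgebra_isHopf k H & Falgebra k H }.

Section Hopf.
Context {k : fieldType} {H : hopfAlgType k}.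

(* Elements of [H^*] are linear maps to [k^o]; product and antipode of [H^*]
   are the transposes of [comul] and [antipode]. *)
Definition dual_mul (f g : 'Hom(H, k^o)) : 'Hom(H, k^o) :=
  linfun (tlift (fun a b => f a * g b) \o @comul k H).

Definition dual_antipode (f : 'Hom(H, k^o)) : 'Hom(H, k^o) :=
  (f \o linfun (@antipode k H))%VF.

Definition brace (a b : H) : H :=
  tlift (fun a1 a2 =>
    tlift (fun b1 b2 => a1 * b1 * antipode a2 * antipode b2) (comul b))
  (comul a).

(* A left integral; for semisimple [H] it is automatically two-sided. *)
Definition integral (L : H) : Prop := forall h, h * L = (counit h : k) *: L.

Definition idempotent_integral (L : H) : Prop :=
  [/\ integral L, L != 0 & L * L = L].

End Hopf.

Section Modules.
Context {k : fieldType}.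
Variable H : falgType k.

Definition left_ideal (I : {vspace H}) : Prop := ({:H} * I <= I)%VS.

(* The left regular module is a semisimple module. *)
Definition semisimple : Prop :=
  forall I : {vspace H}, left_ideal I ->
  exists J : {vspace H},
    [/\ left_ideal J, (I + J)%VS = fullv & (I :&: J)%VS = 0%VS].

Record hmodule := HModule {
  carrier :> vectType k;
  act : {linear H -> 'End(carrier)};
  act1 : act 1 = \1%VF;
  actM : forall g h, act (g * h) = (act g \o act h)%VF
}.

Definition irreducible (M : hmodule) : Prop :=
  (0 < \dim {:M})%N /\
  forall U : {vspace M}, (forall h, act M h @: U <= U)%VS ->
    U = 0%VS \/ U = fullv.

Definition isomorphic (M N : hmodule) : Prop :=
  exists2 f : 'Hom(M, N), bijective f &
    forall h, (f \o act M h)%VF = (act N h \o f)%VF.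

Definition character (M : hmodule) : 'Hom(H, k^o) :=
  linfun ((mxtrace : _ -> k^o) \o mxof (vbasis {:M}) (vbasis {:M}) \o act M).

Definition complete_irreducibles n (V : 'I_n -> hmodule) : Prop :=
  [/\ forall i, irreducible (V i),
      forall i j, isomorphic (V i) (V j) -> i = j
    & forall M, irreducible M -> exists i, isomorphic M (V i)].

Definition central_idempotent (e : H) : Prop :=
  e \in 'Z({:H})%VS /\ e * e = e.

Definition primitive_central_idempotent (e : H) : Prop :=
  [/\ central_idempotent e, e != 0
    & forall f g, central_idempotent f -> central_idempotent g ->
        f * g = 0 -> e = f + g -> f = 0 \/ g = 0].

Definition associated_idempotent (M : hmodule) (e : H) : Prop :=
  primitive_central_idempotent e /\ act M e = \1%VF.

End Modules.

(* Column convention: column [j] of [A] holds the coordinates of [T e_j]. *)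
Definition matrix_of_operator (k : fieldType) (V : lmodType k) m
    (T : V -> V) (e : m.-tuple V) (A : 'M[k]_m) : Prop :=
  forall j, T (tnth e j) = \sum_i A i j *: tnth e i.

Definition nonneg_rational (k : fieldType) (x : k) : Prop :=
  exists2 q : rat, 0 <= q & x = ratr q.

Definition pos_rational (k : fieldType) (x : k) : Prop :=
  exists2 q : rat, 0 < q & x = ratr q.

(* Main.v *)
From HB Require Import structures.
Require Import Defs.
From mathcomp Require Import all_boot all_order all_algebra all_field.
From mathcomp Require Import mxtens ring.

Set Implicit Arguments.
Unset Strict Implicit.
Unset Printing Implicit Defensive.

Import Order.TTheory Num.Theory GRing.Theory passmx.
Local Open Scope ring_scope.

(** Write Lambda for the idempotent integral [L], [Lambda_1 (x) Lambda_2] for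
its coproduct, [rho i] for the matrix representation on [V i], [d_i] for its
dimension and [chi_i] for its character.

By Schur's lemma the average of [X] given by
[rho i Lambda_1 * X * rho i (S Lambda_2)] is the scalar [tr (X * w_i)] for a
matrix [w_i] of trace 1.  If [w_i = 1 / d_i], the theorem follows at once.  The
image [T z] of a central [z] acts on [V i] as [rho i z_1 * chi_i (S z_2) / d_i];
the element [z_1 chi_i (S z_2)] is central because [S] is an involution, so
[T z] is the sum over [i] of [f_i(z) / d_i^2] times [E i], where
[f_i = chi_i s(chi_i)] is the character of the adjoint action on [End (V i)].
Since [E j] is [d_j Lambda_1 chi_j (S Lambda_2)], the entry [A i j] equals
[f_i(E j) / d_j^2].  The number [f_i(E j)] is the trace of an idempotent matrix,
hence a natural number; it is 1 for [j = 0] because only scalars commute with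
[V i]; and [f_0] is the counit.  These facts give all four parts.

The content is therefore the equality [w_i = 1 / d_i], which is equivalent to
the theorem of Larson and Radford that [S] is an involution ([weight_scalar],
[antipode2]).  In general [w_i] is invertible and conjugation by it is the
square of the antipode.  The functional sending [h] to the sum of
[tr (w_i^-1 * rho i h)] is a left integral [lambda] of the dual, and the
elements [h_1 lambda(h_2)] are multiples of one grouplike element [g], which
implements the fourth power of the antipode.  So [w_i] can be rescaled to [u_i]
with [u_i^2 = rho i g] ([weight_sqr_modular]), and the argument has two steps.

First, [lambda(1)] is not zero ([dual_int1_neq0]).  The multiplicity spaces
[Hom_H (V l, V i (x) V j)] carry the involution induced by [u]; its trace is an
integer, a signed fusion coefficient.  The traces [c_i = tr u_i] form a common
eigenvector of the matrices of these coefficients, and [lambda(1)] is the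
eigenvalue of their Gram matrix.  That matrix is an integral positive definite
matrix, hence remains invertible over any field of characteristic zero.  As
[lambda(1)] is not zero, evaluating at 1 gives [g = 1] and [u_i^2 = 1], and [c_i]
is an integer of absolute value at most [d_i].

Second, [lambda(1)] is both the sum of the [c_i^2] and an integral multiple of
the sum of the [d_i^2] ([dual_int1_multiple]): convolution with the regular
character is, up to that factor, an idempotent commuting with the square of the
antipode, and [lambda(1)] is the trace of their composite.  Being nonzero, the
first sum is at least the second, so [c_i] is [d_i] up to sign, [u_i] is a
scalar, and so is [w_i]. *)

(** * Linearity and sums over a coproduct *)

(** Linearity of a bare function.  The summands below are open terms in several
    variables, for which bundled linear maps would have to be rebuilt at each
    use; the tactic [lin] derives this predicate from the shape of the term. *)
Definition lin (R : pzRingType) (U V : lmodType R) (f : U -> V) :=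
  forall (c : R) (u v : U), f (c *: u + v) = c *: f u + f v.

(** The field as a vector space: unification does not find this structure from
    a [k]-valued summand. *)
Notation scalars k := (GRing_regular__canonical__vector_Vector k).

Section Lin.
Context {k : fieldType}.
Implicit Types U V W : vectType k.

Lemma lin_id (U : lmodType k) : lin (fun x : U => x).
Proof. by []. Qed.

Lemma lin_lfun (U V W : lmodType k) (g : {linear V -> W}) (f : U -> V) :
  lin f -> lin (fun x => g (f x)).
Proof. by move=> fl c u v; rewrite fl linearP. Qed.

Lemma lin_app (U V W : lmodType k) (g : V -> W) (f : U -> V) :
  lin g -> lin f -> lin (fun x => g (f x)).
Proof. by move=> gl fl c u v; rewrite fl gl. Qed.

Lemma lin_sum (U V : lmodType k) (I : Type) (r : seq I) (P : pred I)
    (f : I -> U -> V) :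
  (forall i, lin (f i)) -> lin (fun x => \sum_(i <- r | P i) f i x).
Proof.
move=> fl c u v; rewrite scaler_sumr -big_split /=.
by apply: eq_bigr => i _; rewrite fl.
Qed.

Lemma lin_mull (U : lmodType k) (A : algType k) (a : A) (f : U -> A) :
  lin f -> lin (fun x => a * f x).
Proof. by move=> fl c u v; rewrite fl mulrDr scalerAr. Qed.

Lemma lin_mulr (U : lmodType k) (A : algType k) (a : A) (f : U -> A) :
  lin f -> lin (fun x => f x * a).
Proof. by move=> fl c u v; rewrite fl mulrDl scalerAl. Qed.

Lemma lin_mulkl (U : lmodType k) (a : k) (f : U -> k^o) :
  lin f -> lin (fun x => a * (f x : k) : k^o).
Proof. by move=> fl c u v; rewrite fl [LHS]mulrDr -![_ *: _]/(_ * _) mulrCA.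
  Qed.

Lemma lin_mulkr (U : lmodType k) (a : k) (f : U -> k^o) :
  lin f -> lin (fun x => (f x : k) * a : k^o).
Proof. by move=> fl c u v; rewrite fl [LHS]mulrDl -![_ *: _]/(_ * _) mulrA. Qed.

Lemma lin_scalel (U V : lmodType k) (a : V) (f : U -> k^o) :
  lin f -> lin (fun x => (f x : k) *: a).
Proof. by move=> fl c u v; rewrite fl scalerDl scalerA. Qed.

Lemma lin_scaler (U V : lmodType k) (a : k) (f : U -> V) :
  lin f -> lin (fun x => a *: f x).
Proof. by move=> fl c u v; rewrite fl scalerDr !scalerA mulrC. Qed.

Lemma lin_mulmxl (U : lmodType k) m n p (A : 'M[k]_(m, n))
    (f : U -> 'M[k]_(n, p)) :
  lin f -> lin (fun x => A *m f x).
Proof. by move=> fl c u v; rewrite fl mulmxDr scalemxAr. Qed.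

Lemma lin_mulmxr (U : lmodType k) m n p (A : 'M[k]_(n, p))
    (f : U -> 'M[k]_(m, n)) :
  lin f -> lin (fun x => f x *m A).
Proof. by move=> fl c u v; rewrite fl mulmxDl scalemxAl. Qed.

Lemma lin_tensl (U : lmodType k) m n p q (A : 'M[k]_(m, n))
    (f : U -> 'M[k]_(p, q)) :
  lin f -> lin (fun x => A *t f x).
Proof.
move=> fl c u v; rewrite fl; apply/matrixP => i j.
by rewrite !mxE mulrDr mulrCA.
Qed.

Lemma lin_tensr (U : lmodType k) m n p q (A : 'M[k]_(m, n))
    (f : U -> 'M[k]_(p, q)) :
  lin f -> lin (fun x => f x *t A).
Proof.
move=> fl c u v; rewrite fl; apply/matrixP => i j.
by rewrite !mxE mulrDl mulrA.
Qed.

Lemma lin_tr (U : lmodType k) m n (f : U -> 'M[k]_(m, n)) :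
  lin f -> lin (fun x => (f x)^T).
Proof. by move=> fl c u v; rewrite fl linearP. Qed.

Lemma lin_mxtrace (U : lmodType k) m (f : U -> 'M[k]_m) :
  lin f -> lin (fun x => \tr (f x) : k^o).
Proof. by move=> fl c u v; rewrite fl linearP. Qed.

Lemma lin_tlift (U : lmodType k) V1 V2 W (F : U -> V1 -> V2 -> W)
    (t : tens V1 V2) :
  (forall a b, lin (fun x => F x a b)) -> lin (fun x => tlift (F x) t).
Proof.
by move=> Fl; apply: lin_sum => i; apply: lin_sum => j; apply: lin_scaler.
Qed.

Lemma lin_tlift_tens V1 V2 W (F : V1 -> V2 -> W) : lin (tlift F).
Proof. by move=> c x y; rewrite linearP. Qed.

Lemma lin_pure1 U V W (v : V) (f : W -> U) :
  lin f -> lin (fun x => pure (f x) v).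
Proof.
move=> fl c x y; apply/matrixP => i j.
by rewrite !mxE fl linearP mulrDl mulrA.
Qed.

Lemma lin_pure2 U V W (u : U) (f : W -> V) :
  lin f -> lin (fun x => pure u (f x)).
Proof.
move=> fl c x y; apply/matrixP => i j.
by rewrite !mxE fl linearP mulrDr mulrCA.
Qed.

Lemma linZ (U V : lmodType k) (f : U -> V) c x : lin f -> f (c *: x) = c *: f x.
Proof.
move=> fl; have f0 : f 0 = 0.
  by apply: (addrI (f 0)); have := fl 1 0 0; rewrite !scale1r !addr0.
by have := fl c x 0; rewrite f0 !addr0.
Qed.

Lemma lin_bigsum (U V : lmodType k) (f : U -> V) I r (P : pred I) (F : I -> U) :
  lin f -> f (\sum_(i <- r | P i) F i) = \sum_(i <- r | P i) f (F i).
Proof.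
move=> fl; apply: big_morph; last by rewrite -(scale0r 0) linZ // scale0r.
by move=> x y; have := fl 1 x y; rewrite !scale1r.
Qed.

Lemma lin_entry (U : lmodType k) m n (f : U -> 'M[k]_(m, n)) i j :
  lin f -> lin (fun x => f x i j : k^o).
Proof. by move=> fl c u v; rewrite fl !mxE. Qed.

Lemma tlift_lin U V W (X : vectType k) (f : W -> X) (F : U -> V -> W)
    (t : tens U V) :
  lin f -> f (tlift F t) = tlift (fun u v => f (F u v)) t.
Proof.
move=> fl; rewrite /tlift lin_bigsum //; apply: eq_bigr => i _.
by rewrite lin_bigsum //; apply: eq_bigr => j _; rewrite linZ.
Qed.

End Lin.

Section Sweedler.
Context {k : fieldType} {H : hopfAlgType k}.
Implicit Types (V W : vectType k) (g h : H).

(** The sum written [F h_1 h_2] in the notation of Sweedler. *)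
Definition sw W (F : H -> H -> W) h : W := tlift F (comul h).
Local Notation S := (@antipode k H).
Local Notation eps := (@counit k H).

Lemma eq_sw W (F G : H -> H -> W) h :
  (forall a b, F a b = G a b) -> sw F h = sw G h.
Proof.
by move=> FG; apply: eq_bigr => i _; apply: eq_bigr => j _; rewrite FG.
Qed.

Lemma eq_sw_scalar (F G : H -> H -> k^o) h :
  (forall a b, F a b = G a b) -> sw F h = sw G h.
Proof. exact: eq_sw. Qed.

Lemma lin_sw W (V : lmodType k) (F : H -> H -> W) (f : V -> H) :
  lin f -> lin (fun x => sw F (f x)).
Proof. by move=> fl c x y; rewrite /sw fl !linearP. Qed.

Lemma lin_sw_in (U : lmodType k) W (F : U -> H -> H -> W) h :
  (forall a b, lin (fun x => F x a b)) -> lin (fun x => sw (F x) h).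
Proof. exact: lin_tlift. Qed.

Lemma sw_lin V W (f : V -> W) (F : H -> H -> V) h :
  lin f -> f (sw F h) = sw (fun a b => f (F a b)) h.
Proof. exact: tlift_lin. Qed.

Lemma sw_lin_scalar V (f : V -> k^o) (F : H -> H -> V) h :
  lin f -> f (sw F h) = sw (fun a b => f (F a b)) h.
Proof. exact: sw_lin. Qed.

Lemma sw_scale W (F : H -> H -> W) (c : k) h :
  sw (fun a b => c *: F a b) h = c *: sw F h.
Proof. by rewrite -(sw_lin _ _ (lin_scaler c (@lin_id _ _))). Qed.

Lemma sw_sum W I r (P : pred I) (F : I -> H -> H -> W) h :
  sw (fun a b => \sum_(i <- r | P i) F i a b) h =
  \sum_(i <- r | P i) sw (F i) h.
Proof.
rewrite /sw /tlift.
under eq_bigr => i _ do under eq_bigr => j _ do rewrite scaler_sumr.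
under eq_bigr => i _ do rewrite exchange_big.
by rewrite exchange_big.
Qed.

Lemma sw_exchange W (F : H -> H -> H -> H -> W) g h :
  sw (fun a b => sw (F a b) h) g =
  sw (fun c d => sw (fun a b => F a b c d) g) h.
Proof.
rewrite /sw /tlift.
under eq_bigr => i _ do under eq_bigr => j _ do rewrite scaler_sumr.
under eq_bigr => i _ do rewrite exchange_big.
rewrite exchange_big; apply: eq_bigr => p _ /=.
under eq_bigr => i _ do
  under eq_bigr => j _ do rewrite scaler_sumr.
under eq_bigr => i _ do rewrite exchange_big /=.
rewrite exchange_big; apply: eq_bigr => q _ /=.
rewrite scaler_sumr; apply: eq_bigr => i _.
rewrite scaler_sumr; apply: eq_bigr => j _.
by rewrite !scalerA mulrC.
Qed.

End Sweedler.

(** Linearity in a variable occurring once.  For a binary operation the pattern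
    does not tell which side holds the variable, so both lemmas are tried. *)
Ltac lin :=
  cbn beta; intros; cbn beta;
  lazymatch goal with
  | |- lin (fun x => x) => exact (@lin_id _ _)
  | |- lin (fun x => @sw _ _ _ _ (@?h x)) =>
      first [apply: (@lin_sw _ _ _ _ _ h) | apply: lin_sw_in]; lin
  | |- lin (fun x => pure (@?f x) (@?g x)) =>
      first [apply: (@lin_pure2 _ _ _ _ _ g) | apply: (@lin_pure1 _ _ _ _ _ f)];
      lin
  | |- lin (fun x => tlift _ _) => apply: lin_tlift; lin
  | |- lin (fun x => @?f x *m @?g x) =>
      first [ apply: (@lin_mulmxl _ _ _ _ _ _ g)
            | apply: (@lin_mulmxr _ _ _ _ _ _ f)]; lin
  | |- lin (fun x => @?f x *t @?g x) =>
      first [ apply: (@lin_tensl _ _ _ _ _ _ _ g)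
            | apply: (@lin_tensr _ _ _ _ _ _ _ f)]; lin
  | |- lin (fun x => (@?f x)^T) => apply: (@lin_tr _ _ _ _ f); lin
  | |- lin (fun x => \tr (@?f x)) => apply: (@lin_mxtrace _ _ _ f); lin
  | |- lin (fun x => @?f x *: @?g x) =>
      first [ apply: (@lin_scaler _ _ _ _ g)
            | apply: (@lin_scalel _ _ _ _ f)]; lin
  | |- lin (fun x => @?f x * @?g x) =>
      first [ apply: (@lin_mull _ _ _ _ g)
            | apply: (@lin_mulr _ _ _ _ f)
            | apply: (@lin_mulkl _ _ _ g)
            | apply: (@lin_mulkr _ _ _ f)]; lin
  | |- lin (fun x => \sum_(i <- _ | _) _) => apply: lin_sum; lin
  | |- lin (fun x => @GRing.Linear.sort _ _ _ _ ?g (@?f x)) =>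
      apply: (@lin_lfun _ _ _ _ g f); lin
  | |- lin (fun x => _) =>
      first
      [ solve [eauto with lindb]
      | lazymatch goal with
        | |- lin (fun x => ?g (@?f x)) =>
            apply: (@lin_app _ _ _ _ g f); [solve [eauto with lindb] | lin]
        end
      | lazymatch goal with
        | |- lin (fun x => ?g (@?f x) ?b) =>
            apply: (@lin_app _ _ _ _ (fun y => g y b) f);
            [solve [eauto with lindb] | lin]
        end
      | lazymatch goal with
        | |- lin (fun x => ?g (@?f x) ?b ?c) =>
            apply: (@lin_app _ _ _ _ (fun y => g y b c) f);
            [solve [eauto with lindb] | lin]
        end]
  | |- lin ?f => first [solve [eauto with lindb]
                       | change (lin (fun x => f x)); lin]
  | |- _ => idtac
  end.
Create HintDb lindb.

Section SweedlerMatrix.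
Context {k : fieldType} {H : hopfAlgType k}.
Implicit Types (h : H).

Lemma mulmx_swr m n p (A : 'M[k]_(m, n)) (F : H -> H -> 'M[k]_(n, p)) h :
  A *m sw F h = sw (fun a b => A *m F a b) h.
Proof. by apply: (@sw_lin _ _ _ _ (fun X => A *m X)); lin. Qed.

Lemma mulmx_swl m n p (A : 'M[k]_(n, p)) (F : H -> H -> 'M[k]_(m, n)) h :
  sw F h *m A = sw (fun a b => F a b *m A) h.
Proof. by apply: (@sw_lin _ _ _ _ (fun X => X *m A)); lin. Qed.

Lemma mxtrace_sw m (F : H -> H -> 'M[k]_m) h :
  \tr (sw F h) = sw (fun a b => \tr (F a b) : k^o) h.
Proof. by rewrite (@sw_lin_scalar k H _ (fun X => \tr X : k^o)); lin. Qed.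

End SweedlerMatrix.

(** * Identities for the antipode *)
Section HopfRules.
Context {k : fieldType} {H : hopfAlgType k}.
Implicit Types (V W : vectType k) (g h : H).

Local Notation S := (@antipode k H).
Local Notation eps h := (@counit k H h : k).

(** Coassociativity; trilinearity of [F] is what lets it factor through the
    threefold tensor product in which [comulA] lives. *)
Lemma sw_assoc W (F : H -> H -> H -> W) h :
    (forall b c, lin (fun a => F a b c)) ->
    (forall a c, lin (fun b => F a b c)) ->
    (forall a b, lin (F a b)) ->
  sw (fun a b => sw (fun c d => F c d b) a) h =
  sw (fun a b => sw (fun c d => F a c d) b) h.
Proof.
move=> F1 F2 F3.
pose G : tens H (tens H H : vectType k) -> W :=
  tlift (fun a t => tlift (fun b c => F a b c) t).
have Gl : lin G by exact: lin_tlift_tens.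
have GE a t : G (pure a t) = tlift (fun b c => F a b c) t.
  rewrite /G tliftE // => x; first by apply: lin_tlift => b c; exact: F1.
  by move=> c u v; rewrite linearP.
have := congr1 G (comulA h); rewrite /tassoc /tmap.
rewrite !(tlift_lin _ _ (lin_tlift_tens _)) !(tlift_lin _ _ Gl) => E.
transitivity (sw (fun a b => G (pure a (comul b))) h); last first.
  by apply: eq_sw => a b; rewrite GE.
rewrite -[RHS]E; apply: eq_sw => a b.
rewrite tliftE; [ | by move=> w; exact: lin_tlift_tens
                  | move=> x; apply: lin_tlift => p q; lin].
rewrite (tlift_lin _ _ Gl); apply: eq_sw => c d.
rewrite GE tliftE // => x; [exact: F2 | exact: F3].
Qed.

Lemma sw_epsl W (f : H -> W) h :
  lin f -> sw (fun a b => eps a *: f b) h = f h.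
Proof.
move=> fl; rewrite -[in RHS](counitl h) (tlift_lin _ _ fl).
by apply: eq_sw => a b; rewrite linZ.
Qed.

Lemma sw_epsr W (f : H -> W) h :
  lin f -> sw (fun a b => eps b *: f a) h = f h.
Proof.
move=> fl; rewrite -[in RHS](counitr h) (tlift_lin _ _ fl).
by apply: eq_sw => a b; rewrite linZ.
Qed.

Lemma sw_SL W (f : H -> W) h :
  lin f -> sw (fun a b => f (S a * b)) h = eps h *: f 1.
Proof.
by move=> fl; rewrite -[RHS](linZ _ _ fl) -antipodel (tlift_lin _ _ fl).
Qed.

Lemma sw_SR W (f : H -> W) h :
  lin f -> sw (fun a b => f (a * S b)) h = eps h *: f 1.
Proof.
by move=> fl; rewrite -[RHS](linZ _ _ fl) -antipoder (tlift_lin _ _ fl).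
Qed.

Lemma sw_mul W (F : H -> H -> W) g h :
    (forall b, lin (fun a => F a b)) -> (forall a, lin (F a)) ->
  sw F (g * h) = sw (fun a b => sw (fun c d => F (a * c) (b * d)) h) g.
Proof.
move=> Fl Fr; rewrite /sw comulM /tmul !(tlift_lin _ _ (lin_tlift_tens _)).
apply: eq_sw => a b; rewrite (tlift_lin _ _ (lin_tlift_tens _)).
by apply: eq_sw => c d; rewrite tliftE.
Qed.

Lemma sw_1 W (F : H -> H -> W) :
    (forall b, lin (fun a => F a b)) -> (forall a, lin (F a)) ->
  sw F 1 = F 1 1.
Proof.
by move=> Fl Fr; rewrite /sw comul1 tliftE.
Qed.

(** In the next four variants the summand has to match only pointwise, which
    avoids higher-order matching at the places of use. *)
Lemma sw_epslE W (F : H -> H -> W) (f : H -> W) h :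
  lin f -> (forall a b, F a b = eps a *: f b) -> sw F h = f h.
Proof. by move=> fl Ff; rewrite (eq_sw _ Ff) sw_epsl. Qed.

Lemma sw_epsrE W (F : H -> H -> W) (f : H -> W) h :
  lin f -> (forall a b, F a b = eps b *: f a) -> sw F h = f h.
Proof. by move=> fl Ff; rewrite (eq_sw _ Ff) sw_epsr. Qed.

Lemma sw_SLE W (F : H -> H -> W) (f : H -> W) h :
  lin f -> (forall a b, F a b = f (S a * b)) -> sw F h = eps h *: f 1.
Proof. by move=> fl Ff; rewrite (eq_sw _ Ff) sw_SL. Qed.

Lemma sw_SRE W (F : H -> H -> W) (f : H -> W) h :
  lin f -> (forall a b, F a b = f (a * S b)) -> sw F h = eps h *: f 1.
Proof. by move=> fl Ff; rewrite (eq_sw _ Ff) sw_SR. Qed.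

(** Both sides are convolution inverses of the product of [H]: the sum [X] below
    collapses to one or the other, depending on which pair of legs is contracted
    first. *)
Lemma antipodeM g h : S (g * h) = S h * S g.
Proof.
pose X := sw (fun a b => sw (fun c d => sw (fun p q => sw (fun r s =>
  S (a * p) * (c * r) * (S s * S d)) q) h) b) g.
transitivity X.
  apply/esym/(sw_epsrE (f := fun x => S (x * h))); first lin.
  move=> a b; rewrite -[X in _ *: X]mulr1.
  apply: (sw_SRE (f := fun x => S (a * h) * x)); first lin.
  move=> c d; apply: (sw_epsrE (f := fun x => S (a * x) * (c * S d)));
    first lin.
  move=> p q; rewrite -{2}[c]mulr1.
  apply: (sw_SRE (f := fun x => S (a * p) * (c * x * S d))); first lin.
  by move=> r s; rewrite !mulrA.
rewrite /X.
transitivity (sw (fun a b => sw (fun p q => sw (fun c d => sw (fun r s =>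
   S (c * r) * (d * s) * (S q * S b)) p) a) h) g).
  rewrite [RHS](_ : _ = sw (fun a b => sw (fun c d => sw (fun p q => sw (fun r
    s =>
   S (c * r) * (d * s) * (S q * S b)) p) h) a) g); last first.
    by apply: eq_sw => a b; rewrite sw_exchange.
  rewrite sw_assoc; try lin; apply: eq_sw => a b; apply: eq_sw => c d.
  by rewrite sw_assoc; try lin.
apply: (sw_epslE (f := fun x => S h * S x)); first lin.
move=> a b.
apply: (sw_epslE (f := fun x => eps a *: (S x * S b))); first lin.
move=> p q; rewrite -[S q * S b in RHS]mul1r scalerA mulrC -counitM.
rewrite -(sw_SL (f := fun x => x * (S q * S b))); last lin.
by rewrite sw_mul; try lin.
Qed.

Lemma antipode1 : S 1 = 1.
Proof.
transitivity (sw (fun a b => S a * b) 1); first by rewrite sw_1 ?mulr1; lin.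
by rewrite (sw_SL _ (@lin_id _ _)) counit1 scale1r.
Qed.

Lemma counit_antipode h : eps (S h) = eps h.
Proof.
transitivity (sw (fun a b => eps (S a) *: (eps b : k^o)) h).
  apply/esym/(sw_epsrE (f := fun x => @counit k H (S x))); first lin.
  by move=> a b; rewrite /GRing.scale /= mulrC.
transitivity ((eps h : k) *: (eps 1 : k^o)); last first.
  by rewrite counit1 /GRing.scale /= mulr1.
rewrite -(sw_SL (f := @counit k H)); last lin.
by apply: eq_sw_scalar => a b; rewrite counitM.
Qed.

(** The antipode reverses coproducts; again by contracting a fivefold sum from
    either end. *)
Lemma sw_antipode W (F : H -> H -> W) h :
    (forall b, lin (fun a => F a b)) -> (forall a, lin (F a)) ->
  sw F (S h) = sw (fun a b => F (S b) (S a)) h.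
Proof.
move=> Fl Fr.
pose X := sw (fun a b => sw (fun c d => sw (fun e f => sw (fun c1 c2 =>
  sw (fun p q => F (p * (c1 * S f)) (q * (c2 * S e))) (S a)) c) d) b) h.
transitivity X.
  apply/esym/(sw_epsrE (f := fun x => sw F (S x))); first lin.
  move=> a b.
  transitivity (sw (fun c1 y => sw (fun x f => sw (fun c2 e =>
    sw (fun p q => F (p * (c1 * S f)) (q * (c2 * S e))) (S a)) x) y) b).
    transitivity (sw (fun c d => sw (fun c1 c2 => sw (fun e f =>
      sw (fun p q => F (p * (c1 * S f)) (q * (c2 * S e))) (S a)) d) c) b).
      by apply: eq_sw => c d; rewrite sw_exchange.
    rewrite sw_assoc; try lin.
    by apply: eq_sw => c1 y; rewrite sw_assoc; try lin.
  transitivity (sw (fun c1 y =>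
    sw (fun p q => F (p * (c1 * S y)) q) (S a)) b).
    apply: eq_sw => c1 y.
    apply: (sw_epslE (f := fun f =>
      sw (fun p q => F (p * (c1 * S f)) q) (S a))); first lin.
    move=> x f.
    transitivity (eps x *: sw (fun p q => F (p * (c1 * S f)) (q * 1)) (S a)).
      apply: (sw_SRE (f := fun z =>
        sw (fun p q => F (p * (c1 * S f)) (q * z)) (S a))) => //; lin.
    by congr (_ *: _); apply: eq_sw => p q; rewrite mulr1.
  transitivity (eps b *: sw (fun p q => F (p * 1) q) (S a)).
    by apply: (sw_SRE (f := fun z => sw (fun p q => F (p * z) q) (S a))) => //;
      lin.
  by congr (_ *: _); apply: eq_sw => p q; rewrite mulr1.
rewrite /X.
transitivity (sw (fun a' b => sw (fun a c => sw (fun e f => sw (fun c1 c2 =>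
  sw (fun p q => F (p * (c1 * S f)) (q * (c2 * S e))) (S a)) c) b) a') h).
  by rewrite sw_assoc; try lin.
apply: (sw_epslE (f := sw (fun a b => F (S b) (S a)))); first lin.
move=> a' b; rewrite sw_exchange -sw_scale; apply: eq_sw => e f.
transitivity (eps a' *: sw (fun p q => F (p * S f) (q * S e)) 1); last first.
  by rewrite sw_1 ?mul1r //; lin.
apply: (sw_SLE (f := sw (fun p q => F (p * S f) (q * S e)))); first lin.
move=> a c; rewrite sw_exchange sw_mul; try lin.
by apply: eq_sw => p q; apply: eq_sw => c1 c2; rewrite !mulrA.
Qed.
End HopfRules.

(** * Moving elements across an integral *)
Section Integral.
Context {k : fieldType} {H : hopfAlgType k}.
Implicit Types (V W : vectType k) (g h : H).

Local Notation S := (@antipode k H).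
Local Notation eps h := (@counit k H h : k).

Variable L : H.
Hypothesis intl : forall h, h * L = eps h *: L.

Lemma sw_intl W (F : H -> H -> W) h :
    (forall b, lin (fun a => F a b)) -> (forall a, lin (F a)) ->
  sw (fun a b => sw (fun c d => F (a * c) (b * d)) L) h = eps h *: sw F L.
Proof.
by move=> Fl Fr; rewrite -sw_mul // intl (linZ _ _ (lin_sw _ (@lin_id _ _))).
Qed.

(** Insert [S h_2 h_3] to complete [h_1 Lambda] to the coproduct of [h Lambda].
    This is why averaging with [Lambda_1] and [S Lambda_2] yields
    intertwiners. *)
Lemma sw_casimir W (F : H -> H -> W) h :
    (forall b, lin (fun a => F a b)) -> (forall a, lin (F a)) ->
  sw (fun a b => F (h * a) (S b)) L = sw (fun a b => F a (S b * h)) L.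
Proof.
move=> Fl Fr.
transitivity (sw (fun h1 h' => sw (fun h2 h3 =>
  sw (fun a b => F (h1 * a) (S (h2 * b) * h3)) L) h') h).
  apply/esym.
  apply: (sw_epsrE (f := fun x => sw (fun a b => F (x * a) (S b)) L)).
    by lin.
  move=> h1 h'.
  transitivity (eps h' *: sw (fun a b => F (h1 * a) (S b * 1)) L).
    apply: (sw_SLE (f := fun x => sw (fun a b => F (h1 * a) (S b * x)) L)).
      by lin.
    by move=> h2 h3; apply: eq_sw => a b; rewrite antipodeM mulrA.
  by congr (_ *: _); apply: eq_sw => a b; rewrite mulr1.
rewrite -sw_assoc; try lin.
apply: (sw_epslE (f := fun x => sw (fun a b => F a (S b * x)) L)).
  by lin.
move=> h' h3; rewrite -(@sw_intl _ (fun a b => F a (S b * h3))); try lin.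
by [].
Qed.

Lemma sw_intl_antipode W (F : H -> H -> W) h :
    (forall b, lin (fun a => F a b)) -> (forall a, lin (F a)) ->
  sw (fun a b => F (S h * a) b) L = sw (fun a b => F a (h * b)) L.
Proof.
move=> Fl Fr.
transitivity (sw (fun h1 h' => sw (fun h2 h3 =>
  sw (fun a b => F (S h1 * (h2 * a)) (h3 * b)) L) h') h).
  apply/esym.
  apply: (sw_epsrE (f := fun x => sw (fun a b => F (S x * a) b) L)).
    by lin.
  move=> h1 h'; rewrite (@sw_intl _ (fun a b => F (S h1 * a) b)) //; lin.
rewrite -sw_assoc; try lin.
apply: (sw_epslE (f := fun x => sw (fun a b => F a (x * b)) L)).
  by lin.
move=> h' h3.
transitivity (eps h' *: sw (fun a b => F (1 * a) (h3 * b)) L).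
  apply: (sw_SLE (f := fun x => sw (fun a b => F (x * a) (h3 * b)) L)).
    by lin.
  by move=> h1 h2; apply: eq_sw => a b; rewrite mulrA.
by congr (_ *: _); apply: eq_sw => a b; rewrite mul1r.
Qed.

Hypothesis intr : forall h, L * h = eps h *: L.

(** Unlike [sw_casimir] this uses that the integral is a right integral;
    comparing the two is what produces the square of the antipode. *)
Lemma sw_intr_antipode W (F : H -> H -> W) h :
    (forall b, lin (fun a => F a b)) -> (forall a, lin (F a)) ->
  sw (fun a b => F (a * h) b) L = sw (fun a b => F a (b * S h)) L.
Proof.
move=> Fl Fr.
transitivity (sw (fun h1 h' => sw (fun h2 h3 =>
  sw (fun a b => F (a * h1) (b * h2 * S h3)) L) h') h).
  apply/esym.
  apply: (sw_epsrE (f := fun x => sw (fun a b => F (a * x) b) L)).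
    by lin.
  move=> h1 h'.
  transitivity (eps h' *: sw (fun a b => F (a * h1) (b * 1)) L).
    apply: (sw_SRE (f := fun x => sw (fun a b => F (a * h1) (b * x)) L)).
      by lin.
    by move=> h2 h3; apply: eq_sw => a b; rewrite mulrA.
  by congr (_ *: _); apply: eq_sw => a b; rewrite mulr1.
rewrite -sw_assoc; try lin.
apply: (sw_epslE (f := fun x => sw (fun a b => F a (b * S x)) L)).
  by lin.
move=> h' h3; rewrite sw_exchange -(@sw_mul _ _ _ (fun a b => F a (b * S h3)));
  try lin.
by rewrite intr (linZ _ _ (lin_sw _ (@lin_id _ _))).
Qed.

End Integral.

(** * Traces and positivity over the rationals *)
Section Traces.
Context {k : fieldType}.

(** Factor [P] through its image as [C *m R]; idempotence forces
    [R *m C = 1]. *)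
Lemma mxtrace_idem m (P : 'M[k]_m) : P *m P = P -> \tr P = (\rank P)%:R.
Proof.
move=> PP; have [B BC] := row_fullP (col_base_full P).
have [B' RB'] := row_freeP (row_base_free P).
have PE := mulmx_base P.
move: (col_base P) (row_base P) => C R in BC RB' PE *.
have RC1 : R *m C = 1%:M.
  have : B *m (C *m R *m (C *m R)) *m B' = B *m (C *m R) *m B'.
    by rewrite PE PP.
  by rewrite !mulmxA BC !mul1mx -mulmxA RB' mulmx1.
by rewrite -{1}PE mxtrace_mulC RC1 mxtrace1.
Qed.

Hypothesis hk : [pchar k] =i pred0.

Let two_neq0 : 2%:R != 0 :> k.
Proof. by move/pcharf0P: hk => ->. Qed.

Let half2 : 2%:R^-1 *+ 2 = 1 :> k.
Proof. by rewrite -[LHS]mulr_natr mulVf. Qed.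

Lemma pchar0_intr_eq0 (z : int) : (z%:~R == 0 :> k) = (z == 0).
Proof.
have /pcharf0P ch := hk; case: z => d; first by rewrite -pmulrn ch.
by rewrite NegzE rmorphN /= -pmulrn !oppr_eq0 ch.
Qed.

(** The eigenvalues are 0, 1 and -1, and the trace is the difference of the
    ranks of the two spectral idempotents. *)
Lemma mxtrace_cube m (M : 'M[k]_m) :
  M *m M *m M = M -> exists z : int, \tr M = z%:~R.
Proof.
move=> M3.
have idem (a : k) : a * a = 1 ->
    let P := 2%:R^-1 *: (M *m M + a *: M) in P *m P = P.
  move=> a2 P; rewrite /P -scalemxAl -scalemxAr.
  have -> : (M *m M + a *: M) *m (M *m M + a *: M) = 2%:R *: (M *m M + a *: M).
    rewrite mulmxDl !mulmxDr -!scalemxAl -!scalemxAr scalerA a2 scale1r.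
    by rewrite !mulmxA M3 [a *: M + _]addrC -mulr2n -scaler_nat.
  by rewrite !scalerA -mulrA mulVf // mulr1.
have /mxtrace_idem E1 := idem 1 (mulr1 _).
have /mxtrace_idem E2 := idem (-1) (etrans (mulrNN 1 1) (mulr1 _)).
set r1 := \rank _ in E1; set r2 := \rank _ in E2.
exists (r1%:Z - r2%:Z); rewrite rmorphB /= -!pmulrn -E1 -E2.
rewrite !mxtraceZ !mxtraceD !mxtraceZ mul1r mulN1r.
by apply: (mulfI two_neq0); rewrite mulrBr !mulVKf //; ring.
Qed.

Lemma mxtrace_invol m (u : 'M[k]_m) : u *m u = 1%:M ->
  exists2 r : nat, (r <= m)%N &
    \tr u = r%:R *+ 2 - m%:R /\
    ((r == 0) || (r == m) -> exists a, u = a%:M).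
Proof.
move=> u2; pose P := 2%:R^-1 *: (1%:M + u).
have PP : P *m P = P.
  rewrite /P -scalemxAl -scalemxAr mulmxDl !mulmxDr !mul1mx mulmx1 u2.
  rewrite [u + _]addrC -mulr2n -scalerMnr scalerMnl half2.
  by rewrite scale1r.
have uE : u = P *+ 2 - 1%:M.
  rewrite scalerMnl half2 scale1r.
  by rewrite [1%:M + u]addrC addrK.
exists (\rank P); first exact: rank_leq_row.
split; first by rewrite {1}uE linearB /= mxtrace1 mulr2n mxtraceD mxtrace_idem.
case/orP => [|/eqP rP].
  by rewrite mxrank_eq0 uE => /eqP ->; exists (-1); rewrite mul0rn sub0r raddfN.
exists 1; have [B BP] : exists B, B *m P = 1%:M.
  by apply/row_fullP; rewrite /row_full rP.
have P1 : P = 1%:M by rewrite -BP -{2}PP mulmxA BP mul1mx.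
by rewrite uE P1 mulr2n addrK.
Qed.

(** The Gram matrix of the integral vectors [z a] is singular over [k] only if
    it is singular over the rationals, and there a kernel vector [v] has [v G
    v^T] equal to a sum of squares. *)
Lemma gram_kernel m (I : finType) (z : I -> 'I_m -> int) (c : 'I_m -> k) :
    (forall l, \sum_a \sum_j (z a j)%:~R * (z a l)%:~R * c j = 0) ->
    (exists j, c j != 0) ->
  exists2 v : 'I_m -> rat,
    (exists j, v j != 0) & forall a, \sum_j (z a j)%:~R * v j = 0.
Proof.
move=> cG [j0 cj0].
pose G : 'M[rat]_m := \matrix_(j, l) \sum_a (z a j * z a l)%:~R.
pose Gz : 'M[int]_m := \matrix_(j, l) \sum_a (z a j * z a l).
have detG0 : \det Gz = 0.
  have : (\det Gz)%:~R = 0 :> k.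
    rewrite -(det_map_mx (intr : int -> k)); apply/eqP/det0P.
    exists (\row_j c j).
      by apply: contraNneq cj0 => /rowP/(_ j0); rewrite !mxE => ->.
    apply/rowP => l; rewrite mxE [RHS]mxE -[RHS](cG l) exchange_big /=.
    apply: eq_bigr => j _; rewrite !mxE rmorph_sum mulr_sumr.
    by apply: eq_bigr => a _; rewrite rmorphM /= mulrC.
  by move=> /eqP; rewrite pchar0_intr_eq0 => /eqP.
have /det0P [v v0 vG] : \det (map_mx (intr : int -> rat) Gz) == 0.
  by rewrite det_map_mx detG0.
exists (v 0).
  apply/existsP; apply: contraNT v0 => /existsPn v0.
  by apply/eqP/rowP => j; rewrite mxE; apply/eqP; have := v0 j; rewrite negbK.
have: \sum_a (\sum_j (z a j)%:~R * v 0 j) ^+ 2 = 0.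
  transitivity ((v *m map_mx (intr : int -> rat) Gz *m v^T) 0 0); last first.
    by rewrite vG mul0mx mxE.
  rewrite mxE; under [RHS]eq_bigr => l _ do rewrite !mxE mulr_suml.
  under [RHS]eq_bigr => l _ do under eq_bigr => j _ do
    rewrite !mxE rmorph_sum mulr_sumr mulr_suml.
  rewrite exchange_big /=.
  under [RHS]eq_bigr => j _ do rewrite exchange_big.
  rewrite [RHS]exchange_big; apply: eq_bigr => a _ /=.
  rewrite expr2 mulr_suml; apply: eq_bigr => j _.
  rewrite mulr_sumr; apply: eq_bigr => l _.
  by rewrite rmorphM /=; ring.
move=> /eqP; rewrite psumr_eq0; last by move=> a _; rewrite sqr_ge0.
by move=> /allP v2 a; have := v2 a (mem_index_enum _); rewrite sqrf_eq0 => /eqP.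
Qed.
End Traces.

Section TraceForm.
Context {k : fieldType}.

Lemma mul_delta_mxE p m n q (A : 'M[k]_(p, m)) (B : 'M[k]_(n, q)) x y i j :
  (A *m delta_mx x y *m B) i j = A i x * B y j.
Proof.
have AE z : (A *m delta_mx x y) i z = A i x * (z == y)%:R.
  rewrite mxE (bigD1 x) //= big1 ?addr0 ?mxE ?eqxx // => t /negPf tx.
  by rewrite mxE tx mulr0.
rewrite mxE (bigD1 y) //= big1 ?addr0 ?AE ?eqxx ?mulr1 // => z /negPf zy.
by rewrite AE zy mulr0 mul0r.
Qed.

Lemma mxtrace_delta m n (X : 'M[k]_(m, n)) i j :
  \tr (delta_mx j i *m X) = X i j.
Proof.
rewrite mxtrace_mulC /mxtrace (bigD1 i) //= big1 ?addr0 => [|p /negPf pi].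
  rewrite mxE (bigD1 j) //= big1 ?addr0 ?mxE ?eqxx ?mulr1 // => q /negPf qj.
  by rewrite mxE qj mulr0.
by rewrite mxE big1 // => q _; rewrite mxE pi andbF mulr0.
Qed.

Lemma mxtrace_nondeg m n (M N : 'M[k]_(m, n)) :
  (forall A, \tr (A *m M) = \tr (A *m N)) -> M = N.
Proof.
by move=> E; apply/matrixP => i j; rewrite -!(mxtrace_delta _ i j) E.
Qed.

(** Rewrites a product of two traces so that an averaging operation can act
    between the two factors. *)
Lemma mxtrace_mul m n (M : 'M[k]_m) (N : 'M[k]_n) :
  \tr M * \tr N =
  \sum_p \sum_q \tr (delta_mx q p *m (M *m delta_mx p q *m N)).
Proof.
rewrite mulr_suml; apply: eq_bigr => p _; rewrite mulr_sumr.
by apply: eq_bigr => q _; rewrite mxtrace_delta mul_delta_mxE.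
Qed.

Lemma mxtrace_tens m n (M : 'M[k]_m) (N : 'M[k]_n) :
  \tr (M *t N) = \tr M * \tr N.
Proof.
rewrite [RHS]mulr_suml [RHS](eq_bigr _ (fun i _ => mulr_sumr _ _ _ _)).
rewrite pair_big /= /mxtrace.
rewrite (reindex (@mxtens_index m n)) /=.
  by apply: eq_bigr => -[i j] _; rewrite tensmxE.
by exists (@mxtens_unindex m n) => x _; rewrite ?mxtens_indexK ?mxtens_unindexK.
Qed.
End TraceForm.

(** * The Casimir weight of an irreducible representation *)
(** What is used of a semisimple Hopf algebra over an algebraically closed
    field: a complete family of irreducible matrix representations, the first of
    which is the counit.  [sys_unit] is irreducibility, in the form that a
    nonzero matrix whose kernel is stable is invertible; it is also applied to
    maps that intertwine only up to a twist. *)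
Record split_system (k : fieldType) (H : hopfAlgType k) (L : H) (n : nat)
    (m : 'I_n.+1 -> nat) (rho : forall i, {linear H -> 'M[k]_(m i)}) : Prop := {
  sys_intl : forall h, h * L = (counit h : k) *: L;
  sys_epsL : counit L = 1;
  sys_dim : forall i, (0 < m i)%N;
  sys_mul : forall i (g h : H), rho i (g * h) = rho i g *m rho i h;
  sys_one : forall i, rho i 1 = 1%:M;
  sys_faithful : forall h, (forall i, rho i h = 0) -> h = 0;
  sys_schur_neq : forall i j (X : 'M_(m i, m j)), i != j ->
    (forall h, rho i h *m X = X *m rho j h) -> X = 0;
  sys_schur_eq : forall i (X : 'M_(m i)),
    (forall h, rho i h *m X = X *m rho i h) -> exists a, X = a%:M;
  sys_unit : forall i (B : 'M_(m i)), B != 0 ->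
    (forall h, exists C, B *m rho i h = C *m B) -> B \in unitmx;
  sys_trivial : forall h, rho ord0 h = (counit h : k)%:M
}.

Section Blocks.
Context {k : fieldType} {H : hopfAlgType k}.
Local Notation S := (@antipode k H).
Local Notation eps h := (@counit k H h : k).

Context {L : H} {n : nat} {m : 'I_n.+1 -> nat}.
Context {rho : forall i, {linear H -> 'M[k]_(m i)}}.
Hypothesis R : split_system L rho.

Let intl := sys_intl R.
Let epsL : eps L = 1 := sys_epsL R.
Let m_gt0 := sys_dim R.
Let rhoM := sys_mul R.
Let rho1 := sys_one R.
Let faithful := sys_faithful R.
Let schur_neq := sys_schur_neq R.
Let schur_eq := sys_schur_eq R.
Let irr_unit := sys_unit R.
Let rho0 := sys_trivial R.

Lemma rho_inj g h : (forall i, rho i g = rho i h) -> g = h.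
Proof.
move=> E; apply/eqP; rewrite -subr_eq0; apply/eqP/faithful => i.
by rewrite linearB /= E subrr.
Qed.

(** The columns of [rho i L] are intertwiners from the trivial
    representation. *)
Lemma rho_int i : i != ord0 -> rho i L = 0.
Proof.
move=> i0; have c0 : 'I_(m ord0) := Ordinal (m_gt0 ord0).
have X0 (B : 'M_(m i, m ord0)) : rho i L *m B = 0.
  apply: schur_neq => // h.
  by rewrite mulmxA -rhoM intl linearZ /= rho0 -scalemxAl mul_mx_scalar.
apply/matrixP => p q; have /matrixP/(_ p c0) := X0 (delta_mx q c0).
by rewrite -(mulmx1 (_ *m _)) mul_delta_mxE !mxE eqxx mulr1.
Qed.

Lemma int_right h : L * h = eps h *: L.
Proof.
apply: rho_inj => i; have [->|i0] := eqVneq i ord0; last first.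
  by rewrite rhoM linearZ /= rho_int // mul0mx scaler0.
by rewrite rhoM linearZ /= !rho0 epsL mul1mx scalemx1.
Qed.

Definition casimir_map i j (X : 'M[k]_(m i, m j)) : 'M[k]_(m i, m j) :=
  sw (fun a b => rho i a *m X *m rho j (S b)) L.

Local Notation f := casimir_map.

Let f_intertwines i j X h : rho i h *m @f i j X = f X *m rho j h.
Proof.
rewrite mulmx_swr mulmx_swl.
transitivity (sw (fun a b => rho i (h * a) *m X *m rho j (S b)) L).
  by apply: eq_sw => a b; rewrite rhoM !mulmxA.
rewrite (sw_casimir intl (F := fun a b => rho i a *m X *m rho j b)); try lin.
by apply: eq_sw => a b; rewrite rhoM !mulmxA.
Qed.

Lemma casimir_neq i j (X : 'M_(m i, m j)) : i != j -> f X = 0.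
Proof. by move=> ij; apply: schur_neq => // h; apply: f_intertwines. Qed.

Let o i : 'I_(m i) := Ordinal (m_gt0 i).

(** The coefficient matrix of the functional sending [X] to the scalar [f X],
    read off from an arbitrary diagonal entry. *)
Definition casimir_weight i : 'M[k]_(m i) :=
  \matrix_(q, p) f (delta_mx p q : 'M_(m i, m i)) (o i) (o i).
Local Notation w := casimir_weight.

Lemma casimir_eq i (X : 'M_(m i)) : f X = (\tr (X *m w i))%:M.
Proof.
have [a fX] : exists a, f X = a%:M by apply: schur_eq => h;
  apply: f_intertwines.
suff -> : \tr (X *m w i) = f X (o i) (o i) by rewrite fX mxE eqxx.
have fl : lin (fun X : 'M_(m i) => f X (o i) (o i) : k^o).
  by apply: (@lin_entry _ _ _ _ (@f i i)); rewrite /f; lin.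
rewrite [X in RHS]matrix_sum_delta [RHS](lin_bigsum _ _ _ fl).
apply: eq_bigr => p _; rewrite mxE [RHS](lin_bigsum _ _ _ fl).
by apply: eq_bigr => q _; rewrite (linZ _ _ fl) mxE.
Qed.

Let trace_product i j (A : 'M_(m i)) (B : 'M_(m j)) :
  sw (fun a b => \tr (A *m rho i a) * \tr (B *m rho j (S b)) : k^o) L =
  \sum_p \sum_q \tr (delta_mx q p *m (A *m f (delta_mx p q *m B))).
Proof.
transitivity (sw (fun a b => \sum_p \sum_q \tr (delta_mx q p *m
    (A *m (rho i a *m (delta_mx p q *m B) *m rho j (S b)))) : k^o) L).
  apply: eq_sw_scalar => a b; rewrite mxtrace_mul.
  by do 2!apply: eq_bigr => ? _; rewrite !mulmxA.
rewrite sw_sum; apply: eq_bigr => p _; rewrite sw_sum; apply: eq_bigr => q _.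
by rewrite /f !mulmx_swr mxtrace_sw.
Qed.

Lemma orthogonality i (A B : 'M_(m i)) :
  sw (fun a b => \tr (A *m rho i a) * \tr (B *m rho i (S b)) : k^o) L =
  \tr (A *m B *m w i).
Proof.
rewrite trace_product -mulmxA [RHS]/mxtrace; apply: eq_bigr => p _.
rewrite mxE; apply: eq_bigr => q _.
by rewrite casimir_eq mul_mx_scalar -scalemxAr mxtraceZ -mulmxA !mxtrace_delta
  mulrC.
Qed.

Lemma orthogonality_neq i j (A : 'M_(m i)) (B : 'M_(m j)) : i != j ->
  sw (fun a b => \tr (A *m rho i a) * \tr (B *m rho j (S b)) : k^o) L = 0.
Proof.
move=> ij; rewrite trace_product big1 // => p _; rewrite big1 // => q _.
by rewrite casimir_neq // !mulmx0 mxtrace0.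
Qed.

Lemma weight_trace i : \tr (w i) = 1.
Proof.
have := casimir_eq (1%:M : 'M_(m i)); rewrite mul1mx.
move=> /matrixP/(_ (o i) (o i)).
rewrite [RHS]mxE eqxx mulr1n => <-; rewrite /f.
suff -> : sw (fun a b => rho i a *m 1%:M *m rho i (S b)) L = 1%:M.
  by rewrite mxE eqxx.
rewrite -(rho1 i) -[RHS]scale1r -epsL; apply: sw_SRE; first lin.
by move=> a b; rewrite rho1 mulmx1 rhoM.
Qed.

(** Compares the two ways of moving [h] across the integral. *)
Lemma weight_antipode2 i h : w i *m rho i h = rho i (S (S h)) *m w i.
Proof.
apply: mxtrace_nondeg => A.
transitivity (\tr (rho i h *m A *m 1%:M *m w i)).
  by rewrite mulmx1 mulmxA mxtrace_mulC mulmxA.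
transitivity (\tr (A *m (1%:M *m rho i (S (S h))) *m w i)); last first.
  by rewrite mul1mx !mulmxA.
rewrite -!orthogonality.
transitivity (sw (fun a b =>
    \tr (A *m rho i (a * h)) * \tr (1%:M *m rho i (S b)) : k^o) L).
  apply: eq_sw_scalar => a b; congr (_ * _).
  by rewrite rhoM mulmxA [RHS]mxtrace_mulC mulmxA.
rewrite (sw_intr_antipode int_right (F := fun a b =>
    \tr (A *m rho i a) * \tr (1%:M *m rho i (S b)) : k^o)); try lin.
by apply: eq_sw_scalar => a b; rewrite antipodeM rhoM mulmxA.
Qed.

(** By the previous lemma the kernel of [w i] is stable, and its trace is 1. *)
Lemma weight_unit i : w i \in unitmx.
Proof.
apply: irr_unit => [|h]; last by exists (rho i (S (S h)));
  apply: weight_antipode2.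
by apply: contra_eq_neq (weight_trace i) => ->;
  rewrite mxtrace0 eq_sym oner_neq0.
Qed.

(** The square of the antipode is conjugation by [w], hence injective. *)
Lemma antipode_inj h : S h = 0 -> h = 0.
Proof.
move=> Sh; apply: faithful => i; apply: (can_inj (mulKmx (weight_unit i))).
by rewrite weight_antipode2 Sh !linear0 mul0mx ?mulmx0.
Qed.

Lemma antipode_surj h : exists g, S g = h.
Proof.
have ker0 : lker (linfun S) == 0%VS.
  apply/eqP/vspaceP => v; rewrite memv0 memv_ker lfunE /=.
  by apply/eqP/eqP => [/antipode_inj //|->]; rewrite linear0.
exists ((linfun S)^-1%VF h); have := lker0_lfunVK ker0 h.
by rewrite lfunE.
Qed.

Lemma antipode_int : S L = L.
Proof.
have SLr h : S L * h = eps h *: S L.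
  have [g <-] := antipode_surj h.
  by rewrite -antipodeM intl linearZ counit_antipode.
by have := SLr L; rewrite intl counit_antipode epsL !scale1r.
Qed.

End Blocks.

Arguments casimir_map {k H} L {n m} rho {i j} X.

(** * The integral of the dual and its modular element *)
Section DualIntegral.
Context {k : fieldType} {H : hopfAlgType k}.
Local Notation S := (@antipode k H).
Local Notation eps h := (@counit k H h : k).

Context {L : H} {n : nat} {m : 'I_n.+1 -> nat}.
Context {rho : forall i, {linear H -> 'M[k]_(m i)}}.
Hypothesis R : split_system L rho.

Let intl := sys_intl R.
Let epsL : eps L = 1 := sys_epsL R.
Let rhoM := sys_mul R.

Local Notation w := (casimir_weight R).
Let intr := int_right R.

(** If the weights are the inverse dimensions, this is the regular character. *)
Definition dual_int (h : H) : k^o := \sum_i \tr (invmx (w i) *m rho i h).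

Lemma lin_dual_int : lin dual_int.
Proof. by rewrite /dual_int; lin. Qed.
Hint Resolve lin_dual_int : lindb.

(** The Nakayama automorphism of this functional is the square of the
    antipode. *)
Lemma dual_int_antipode2 a b : dual_int (b * a) = dual_int (S (S a) * b).
Proof.
apply: eq_bigr => i _; rewrite !rhoM.
have wa : rho i a *m invmx (w i) = invmx (w i) *m rho i (S (S a)).
  apply: (can_inj (mulKmx (weight_unit R i))).
  rewrite !mulmxA weight_antipode2 mulmxV ?weight_unit // mul1mx.
  by rewrite mulmxK ?weight_unit.
by rewrite !mulmxA -wa [LHS]mxtrace_mulC mulmxA.
Qed.

(** [Lambda_1] and [S Lambda_2] are dual bases for [dual_int]: the inverse
    weight cancels the weight in the orthogonality relation. *)
Lemma casimir_dual_int_r j (A : 'M_(m j)) h :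
  sw (fun a b => \tr (A *m rho j a) * dual_int (S b * h) : k^o) L =
  \tr (A *m rho j h).
Proof.
transitivity (sw (fun a b => \sum_i \tr (A *m rho j a) *
   \tr (rho i h *m invmx (w i) *m rho i (S b)) : k^o) L).
  apply: eq_sw_scalar => a b; rewrite mulr_sumr; apply: eq_bigr => i _.
  by rewrite rhoM mulmxA [\tr (invmx _ *m _ *m _)]mxtrace_mulC mulmxA.
rewrite sw_sum (bigD1 j) //= big1 => [|i /negPf ij]; last first.
  by rewrite orthogonality_neq // eq_sym ij.
by rewrite addr0 orthogonality -!mulmxA mulVmx ?weight_unit // mulmx1.
Qed.

Lemma casimir_dual_int_l j (B : 'M_(m j)) h :
  sw (fun a b => dual_int (h * a) * \tr (B *m rho j (S b)) : k^o) L =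
  \tr (B *m rho j h).
Proof.
transitivity (sw (fun a b => \sum_i \tr (invmx (w i) *m rho i h *m rho i a) *
   \tr (B *m rho j (S b)) : k^o) L).
  apply: eq_sw_scalar => a b; rewrite mulr_suml; apply: eq_bigr => i _.
  by rewrite rhoM mulmxA.
rewrite sw_sum (bigD1 j) //= big1 => [|i /negPf ij]; last first.
  by rewrite orthogonality_neq // ij.
rewrite addr0 orthogonality mxtrace_mulC !mulmxA mulmxV ?weight_unit //.
by rewrite mul1mx mxtrace_mulC.
Qed.

Lemma dual_basis_r h : sw (fun a b => (dual_int (S b * h) : k) *: a) L = h.
Proof.
apply: (rho_inj R) => j; apply: mxtrace_nondeg => A.
rewrite -[RHS]casimir_dual_int_r.
rewrite (@sw_lin_scalar _ _ _ (fun x => \tr (A *m rho j x) : k^o)); try lin.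
by apply: eq_sw_scalar => a b; rewrite linearZ -scalemxAr mxtraceZ mulrC.
Qed.

Lemma dual_basis_l h : sw (fun a b => (dual_int (h * a) : k) *: S b) L = h.
Proof.
apply: (rho_inj R) => j; apply: mxtrace_nondeg => A.
rewrite -[RHS]casimir_dual_int_l.
rewrite (@sw_lin_scalar _ _ _ (fun x => \tr (A *m rho j x) : k^o)); try lin.
by apply: eq_sw_scalar => a b; rewrite linearZ -scalemxAr mxtraceZ.
Qed.

Lemma dual_int_unit : sw (fun a b => (dual_int a : k) *: b) L = 1.
Proof.
apply/eqP; rewrite -subr_eq0; apply/eqP/(antipode_inj R).
rewrite linearB /= antipode1 -[X in _ - X]dual_basis_l.
rewrite (sw_lin _ _ (lin_lfun S (@lin_id _ _))) /=.
apply/eqP; rewrite subr_eq0; apply/eqP; apply: eq_sw => a b.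
by rewrite linearZ mul1r.
Qed.

Lemma dual_int_L : dual_int L = 1.
Proof.
transitivity (@counit k H (sw (fun a b => (dual_int a : k) *: b) L));
  last by rewrite dual_int_unit counit1.
rewrite (@sw_lin_scalar _ _ _ (@counit k H)); try lin.
apply/esym/(sw_epsrE (W := scalars k)).
  exact: lin_dual_int.
by move=> a b; rewrite linearZ; apply: mulrC.
Qed.

Let psi h b : k^o := dual_int (S b * h).

Let lin_psi h : lin (psi h).
Proof. by rewrite /psi; lin. Qed.
Hint Resolve lin_psi : lindb.

Let dual_intE h : dual_int h = psi h 1.
Proof.
rewrite -dual_int_unit (@sw_lin_scalar _ _ _ (psi h)); try lin.
rewrite -[in LHS](dual_basis_r h) (@sw_lin_scalar _ _ _ dual_int); try lin.
apply: eq_sw_scalar => a b; rewrite !(linZ _ _ lin_dual_int).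
rewrite (linZ _ _ (lin_psi h)).
exact: mulrC.
Qed.

(** Every [h] is of the form [Lambda_1 psi(Lambda_2)], which reduces the
    statement to [dual_int_unit] by coassociativity. *)
Lemma dual_int_left h : sw (fun a b => (dual_int a : k) *: b) h =
  (dual_int h : k) *: 1.
Proof.
rewrite dual_intE -[in LHS](dual_basis_r h).
transitivity (sw (fun a b => sw (fun c d =>
   (dual_int c : k) *: ((psi h b : k) *: d)) a) L).
  rewrite (@sw_lin _ _ _ _ (sw (fun a b => (dual_int a : k) *: b))); try lin.
  apply: eq_sw => a b; rewrite (linZ _ _ (lin_sw _ (@lin_id _ _))) -sw_scale.
  by apply: eq_sw => c d; rewrite !scalerA mulrC.
rewrite sw_assoc; try (rewrite /psi; lin).
transitivity (sw (fun a b => (psi h b : k) *: a)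
  (sw (fun a b => (dual_int a : k) *: b) L)).
  rewrite (@sw_lin _ _ _ _ (sw (fun a b => (psi h b : k) *: a))); try lin.
  apply: eq_sw => a b; rewrite (linZ _ _ (lin_sw _ (@lin_id _ _))) -sw_scale.
  by apply: eq_sw => c d; rewrite !scalerA mulrC.
by rewrite dual_int_unit sw_1 //; rewrite /psi; lin.
Qed.

(** The grouplike element by which [dual_int] fails to be a right integral. *)
Definition modular : H := sw (fun a b => (dual_int b : k) *: a) L.
Local Notation g := modular.

Lemma dual_int_right h : sw (fun a b => (dual_int b : k) *: a) h =
  (dual_int h : k) *: g.
Proof.
rewrite -[in LHS](dual_basis_r h).
transitivity (sw (fun a b => sw (fun c d =>
   (psi h b : k) *: ((dual_int d : k) *: c)) a) L).
  rewrite (@sw_lin _ _ _ _ (sw (fun a b => (dual_int b : k) *: a))); try lin.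
  apply: eq_sw => a b; rewrite (linZ _ _ (lin_sw _ (@lin_id _ _))) -sw_scale.
  by [].
rewrite sw_assoc; try (rewrite /psi; lin).
rewrite dual_intE /modular -sw_scale; apply: eq_sw => a b.
transitivity ((psi h (sw (fun c d => (dual_int c : k) *: d) b) : k) *: a).
  rewrite (@sw_lin _ _ _ _ (fun x => (psi h x : k) *: a)); try lin.
  apply: eq_sw => c d; rewrite (linZ _ _ (lin_psi h)) !scalerA.
  by congr (_ *: _); apply: mulrC.
rewrite dual_int_left (linZ _ _ (lin_psi h)) scalerA; congr (_ *: _).
exact: mulrC.
Qed.

(** Coassociativity and [dual_int_right]. *)
Lemma modular_grouplike (W : vectType k) (F : H -> H -> W) :
    (forall b, lin (fun a => F a b)) -> (forall a, lin (F a)) ->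
  sw F g = F g g.
Proof.
move=> Fl Fr; rewrite {1}/modular (sw_lin _ _ (lin_sw F (@lin_id _ _))).
transitivity (sw (fun a b => sw (fun c d => (dual_int b : k) *: F c d) a) L).
  by apply: eq_sw => a b; rewrite (linZ _ _ (lin_sw _ (@lin_id _ _))) sw_scale.
rewrite sw_assoc; try lin.
transitivity (sw (fun a b => F a ((dual_int b : k) *: g)) L).
  apply: eq_sw => a b; rewrite -dual_int_right (sw_lin _ _ (Fr a)).
  by apply: eq_sw => c d; rewrite (linZ _ _ (Fr a)).
rewrite {2}/modular (sw_lin _ _ (Fl g)).
by apply: eq_sw => a b; rewrite (linZ _ _ (Fr a)) (linZ _ _ (Fl g)).
Qed.

Lemma counit_modular : eps g = 1.
Proof.
rewrite -dual_int_L /modular (@sw_lin_scalar _ _ _ (@counit k H)); try lin.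
apply: (sw_epslE (W := scalars k)) => [|a b].
  exact: lin_dual_int.
by rewrite linearZ; apply: mulrC.
Qed.

Lemma modular_antipodel : S g * g = 1.
Proof.
rewrite -(@modular_grouplike _ (fun a b => S a * b)); try lin.
by rewrite (sw_SL _ (@lin_id _ _)) counit_modular scale1r.
Qed.

(** Radford's formula for the fourth power of the antipode, in the unimodular
    case. *)
Lemma modular_antipode4 h : g * h = S (S (S (S h))) * g.
Proof.
rewrite /modular (sw_lin _ _ (lin_mulr h (@lin_id _ _))).
rewrite (sw_lin _ _ (lin_mull _ (@lin_id _ _))).
transitivity (sw (fun a b => (dual_int b : k) *: (a * h)) L).
  by apply: eq_sw => a b; rewrite scalerAl.
rewrite (sw_intr_antipode intr (F := fun a b => (dual_int b : k) *: a));
  try lin.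
transitivity (sw (fun a b => (dual_int b : k) *: (S (S (S (S h))) * a)) L).
  rewrite (sw_intl_antipode intl (F := fun a b => (dual_int b : k) *: a));
    try lin.
  by apply: eq_sw => a b; rewrite dual_int_antipode2.
by apply: eq_sw => a b; rewrite scalerAr.
Qed.

(** Take [h = 1] in [dual_int_right]. *)
Lemma dual_int_unimodular : (dual_int 1 : k) != 0 -> g = 1.
Proof.
move=> l1; have := @sw_1 _ H _ (fun a b => (dual_int b : k) *: a).
rewrite dual_int_right => E.
have {}E : (dual_int 1 : k) *: g = (dual_int 1 : k) *: 1 by apply: E; lin.
by rewrite -[g](scalerK l1) E scalerK.
Qed.

End DualIntegral.

(** * Convolution and twisted representations *)
Section Convolution.
Context {k : fieldType} {H : hopfAlgType k}.
Local Notation S := (@antipode k H).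
Local Notation eps h := (@counit k H h : k).
Implicit Types f : H -> k^o.

Definition conv f1 f2 (h : H) : k^o := sw (fun a b => f1 a * f2 b : k^o) h.

Lemma lin_conv f1 f2 : lin (conv f1 f2).
Proof. exact: lin_sw (@lin_id _ _). Qed.

Lemma eq_conv f1 f2 f1' f2' h :
  f1 =1 f1' -> f2 =1 f2' -> conv f1 f2 h = conv f1' f2' h.
Proof. by move=> E1 E2; apply: eq_sw_scalar => a b; rewrite E1 E2. Qed.

Lemma convA f1 f2 f3 h : lin f1 -> lin f2 -> lin f3 ->
  conv (conv f1 f2) f3 h = conv f1 (conv f2 f3) h.
Proof.
move=> l1 l2 l3; rewrite /conv.
transitivity (sw (fun a b => sw (fun c d => f1 c * f2 d * f3 b : k^o) a) h).
  apply: eq_sw_scalar => a b.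
  by rewrite (@sw_lin_scalar _ _ _ (fun x : k^o => (x : k) * f3 b : k^o)) //;
    lin.
rewrite (sw_assoc (F := fun a b c => f1 a * f2 b * f3 c : k^o)); try lin.
apply: eq_sw_scalar => a b.
rewrite (@sw_lin_scalar _ _ _ (fun x : k^o => f1 a * (x : k) : k^o)); try lin.
by apply: eq_sw_scalar => c d; rewrite mulrA.
Qed.

Lemma conv_antipode f1 f2 h : lin f1 -> lin f2 ->
  conv f1 f2 (S h) = conv (f2 \o S) (f1 \o S) h.
Proof.
move=> l1 l2; rewrite /conv.
rewrite (sw_antipode (F := fun a b => f1 a * f2 b : k^o)); try lin.
by apply: eq_sw_scalar => a b; rewrite mulrC.
Qed.

Lemma sw_grouplike (W : vectType k) (F : H -> H -> W) g : comul g = pure g g ->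
    (forall b, lin (fun a => F a b)) -> (forall a, lin (F a)) ->
  sw F g = F g g.
Proof. by move=> gg Fl Fr; rewrite /sw gg tliftE. Qed.

Lemma conv_grouplike f1 f2 g h : comul g = pure g g -> lin f1 -> lin f2 ->
  conv f1 f2 (g * h) = conv (f1 \o *%R g) (f2 \o *%R g) h.
Proof.
move=> gg l1 l2; rewrite /conv (sw_mul (F := fun a b => f1 a * f2 b : k^o));
  try lin.
by rewrite (sw_grouplike gg) //; lin.
Qed.

Lemma conv_1 f1 f2 : lin f1 -> lin f2 -> conv f1 f2 1 = f1 1 * f2 1.
Proof.
by move=> l1 l2; rewrite /conv (sw_1 (F := fun a b => f1 a * f2 b : k^o)); lin.
Qed.

(** A representation [r] together with an isomorphism [U] to its twist by the
    square of the antipode, normalised so that [U] squares to the action of the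
    grouplike element [g].  Such pairs are closed under tensor products and
    duals. *)
Record twisted (g : H) N (r : H -> 'M[k]_N) (U : 'M[k]_N) : Prop := {
  tw_lin : lin r;
  tw_mul : forall a b, r (a * b) = r a *m r b;
  tw_conj : forall h, r (S (S h)) *m U = U *m r h;
  tw_sq : U *m U = r g
}.

Variables (g : H) (gg : comul g = pure g g).

Lemma twisted_tens N1 N2 r1 r2 (U1 : 'M[k]_N1) (U2 : 'M[k]_N2) :
  twisted g r1 U1 -> twisted g r2 U2 ->
  twisted g (fun h => sw (fun a b => r1 a *t r2 b) h) (U1 *t U2).
Proof.
move=> [l1 m1 c1 s1] [l2 m2 c2 s2]; split.
- by lin.
- move=> a b; rewrite sw_mul; try lin; rewrite mulmx_swl; apply: eq_sw => p q.
  by rewrite mulmx_swr; apply: eq_sw => c d; rewrite m1 m2 tensmx_mul.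
- move=> h; rewrite !sw_antipode; try lin.
  rewrite mulmx_swl mulmx_swr; apply: eq_sw => a b.
  by rewrite !tensmx_mul c1 c2.
- by rewrite (sw_grouplike gg); try lin; rewrite tensmx_mul s1 s2.
Qed.

Lemma twisted_dual N r (U : 'M[k]_N) : S g * g = 1 -> r 1 = 1%:M ->
  twisted g r U -> twisted g (fun h => (r (S h))^T) (invmx U)^T.
Proof.
move=> Sg r1 [l1 m1 c1 s1].
have UU : r (S g) *m U *m U = 1%:M by rewrite -mulmxA s1 -m1 Sg r1.
have Uu : U \in unitmx by have [] := mulmx1_unit UU.
have UE : invmx U = r (S g) *m U.
  by rewrite -[LHS]mul1mx -UU mulmxK.
split.
- by lin.
- by move=> a b; rewrite antipodeM m1 trmx_mul.
- move=> h; rewrite -!trmx_mul; congr (_^T).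
  apply: (can_inj (mulKmx Uu)); apply: (can_inj (mulmxK Uu)).
  by rewrite !mulmxA mulmxV // mul1mx mulmxKV // c1.
- by rewrite -trmx_mul; congr (_^T); rewrite {1}UE mulmxK.
Qed.

(** On the invariants, which are the image of [r L], the map [U] is an
    involution, because [g] acts trivially there. *)
Lemma twisted_trace N r (U : 'M[k]_N) (L : H) : [pchar k] =i pred0 ->
    S L = L -> L * L = L -> L * g = L -> twisted g r U ->
  exists z : int, \tr (r L *m U) = z%:~R.
Proof.
move=> hk SL LL Lg [l1 m1 c1 s1]; apply: mxtrace_cube => //.
have E : r L *m U *m (r L *m U) = r L.
  rewrite mulmxA -[_ *m U *m _]mulmxA -c1 !SL mulmxA -m1 LL -mulmxA s1.
  by rewrite -m1 Lg.
by rewrite E mulmxA -m1 LL.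
Qed.

End Convolution.

(** * The dual integral does not vanish at 1 *)
Section Positivity.
Context {k : fieldType} {H : hopfAlgType k}.
Local Notation S := (@antipode k H).
Local Notation eps h := (@counit k H h : k).

Context {L : H} {n : nat} {m : 'I_n.+1 -> nat}.
Context {rho : forall i, {linear H -> 'M[k]_(m i)}}.
Hypothesis R : split_system L rho.

Let intl := sys_intl R.
Let epsL : eps L = 1 := sys_epsL R.
Let m_gt0 := sys_dim R.
Let rhoM := sys_mul R.
Let rho1 := sys_one R.
Let schur_eq := sys_schur_eq R.
Let rho0 := sys_trivial R.

Hypothesis hk : [pchar k] =i pred0.
Hypothesis sqrtP : forall a : k, exists c, c ^+ 2 = a.
Local Notation w := (casimir_weight R).
Local Notation g := (modular R).
Local Notation dual_int := (dual_int R).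

Lemma comul_modular : comul g = pure g g.
Proof.
transitivity (sw pure g); first exact: (tlift_unique (@idfun _)).
by rewrite modular_grouplike //; lin.
Qed.

Lemma rho_modular_unit i : rho i g \in unitmx.
Proof.
have : rho i (S g) *m rho i g = 1%:M by rewrite -rhoM modular_antipodel rho1.
by case/mulmx1_unit.
Qed.

(** Both [w i *m w i] and [rho i g] implement the fourth power of the antipode,
    so Schur's lemma makes them proportional. *)
Lemma weight_sqr_modular i :
  exists2 c : k, c != 0 & rho i g = (c *: w i) *m (c *: w i).
Proof.
have wu := weight_unit R i.
have wV h : invmx (w i) *m rho i (S (S h)) = rho i h *m invmx (w i).
  apply: (can_inj (mulKmx wu)); rewrite mulKVmx // mulmxA weight_antipode2.
  by rewrite mulmxK.
have [a aE] : exists a, invmx (w i) *m (invmx (w i) *m rho i g) = a%:M.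
  apply: schur_eq => h; rewrite -!mulmxA -rhoM modular_antipode4 rhoM.
  by rewrite [invmx (w i) *m (rho i _ *m _)]mulmxA wV !mulmxA wV.
have gE : rho i g = a *: (w i *m w i).
  by rewrite -mul_mx_scalar -aE -!mulmxA mulKVmx // mulKVmx.
have [c c2] := sqrtP a; exists c.
  apply/eqP => c0; have := rho_modular_unit i.
  rewrite gE -c2 c0 expr0n scale0r => /mulmxV; rewrite mul0mx => /matrixP E.
  have := E (Ordinal (m_gt0 i)) (Ordinal (m_gt0 i)).
  by rewrite !mxE eqxx => /esym/eqP; rewrite oner_eq0.
by rewrite -scalemxAl -scalemxAr scalerA -expr2 c2.
Qed.

Lemma weight_scaling_exists :
  exists c : 'I_n.+1 -> k, forall i,
    c i != 0 /\ rho i g = (c i *: w i) *m (c i *: w i).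
Proof.
have /fin_all_exists[c cP] i : exists c : k,
    c != 0 /\ rho i g = (c *: w i) *m (c *: w i).
  by have [c c0 cE] := weight_sqr_modular i; exists c.
by exists c.
Qed.

Section Scaled.
Variable c : 'I_n.+1 -> k.
Hypothesis c_neq0 : forall i, c i != 0.
Hypothesis cE : forall i, rho i g = (c i *: w i) *m (c i *: w i).

Let u i := c i *: w i.
Let t i h : k^o := \tr (u i *m rho i h).
Let v i h : k^o := \tr (invmx (u i) *m rho i h).

Let u_unit i : u i \in unitmx.
Proof. by rewrite unitmxZ ?weight_unit // unitfE c_neq0. Qed.

Let uV i : c i *: invmx (u i) = invmx (w i).
Proof. by rewrite invmxZ ?weight_unit ?u_unit // scalerA divff ?scale1r. Qed.

Let lin_t i : lin (t i). Proof. by rewrite /t; lin. Qed.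
Let lin_v i : lin (v i). Proof. by rewrite /v; lin. Qed.
Let lin_vS i : lin (v i \o S). Proof. exact: (lin_app (lin_v i) (lin_lfun S
  (@lin_id _ _))). Qed.
Let lin_tS i : lin (t i \o S). Proof. exact: (lin_app (lin_t i) (lin_lfun S
  (@lin_id _ _))). Qed.
Hint Resolve lin_t lin_v lin_tS lin_vS lin_conv : lindb.

Let u_conj i h : rho i (S (S h)) *m u i = u i *m rho i h.
Proof. by rewrite /u -scalemxAl -scalemxAr weight_antipode2. Qed.

Let t1 i : t i 1 = c i.
Proof. by rewrite /t rho1 mulmx1 mxtraceZ weight_trace mulr1. Qed.

Let v1 i : c i * v i 1 = \tr (invmx (w i)).
Proof. by rewrite /v rho1 mulmx1 -mxtraceZ uV. Qed.

Let t_antipode2 i h : t i (S (S h)) = t i h.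
Proof. by rewrite /t -[in RHS]u_conj [RHS]mxtrace_mulC. Qed.

Let v_modular i h : v i (g * h) = t i h.
Proof. by rewrite /v /t rhoM cE -mulmxA -/(u i) mulKmx ?u_unit. Qed.

Let t_antipode_modular i h : t i (S (g * h)) = v i (S h).
Proof.
have E : rho i (S g) *m u i = invmx (u i).
  apply: (can_inj (mulmxK (u_unit i))).
  by rewrite mulVmx ?u_unit // -mulmxA -cE -rhoM modular_antipodel rho1.
by rewrite /t /v antipodeM rhoM mulmxA mxtrace_mulC mulmxA E.
Qed.

(** The trace of the involution on the invariants of the tensor product of [V
    i], [V j] and the dual of [V l], that is, on the multiplicity space of [V l]
    in the product of [V i] and [V j]. *)
Definition fusion i j l : k := conv (conv (t i) (t j)) (v l \o S) L.

(** Multiply [L] by [g], which turns each of the three twists into its inverse,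
    then apply the antipode, which reverses the order of the factors. *)
Let fusion_flip i j l :
  fusion i j l = conv (t l) (conv (v j \o S) (v i \o S)) L.
Proof.
transitivity (conv (conv (v i) (v j)) (t l \o S) (g * L)).
  rewrite conv_grouplike ?comul_modular //; try lin.
  apply: eq_conv => h /=; last by rewrite t_antipode_modular.
  rewrite conv_grouplike ?comul_modular //; try lin.
  by apply: eq_conv => x /=; rewrite v_modular.
rewrite intl counit_modular scale1r -{1}(antipode_int R).
rewrite conv_antipode //; try lin.
apply: eq_conv => h /=; first by rewrite t_antipode2.
by rewrite conv_antipode //; lin.
Qed.

(** Expansion of [f] along the twisted characters, evaluated at 1; it holds for
    every functional because [dual_int] is the sum of the [c l * v l]. *)
Let conv_dual_int f : lin f -> \sum_l c l * conv f (v l \o S) L = f 1.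
Proof.
move=> fl; rewrite -[in RHS](dual_basis_r R 1) (@sw_lin_scalar _ _ _ f) //.
transitivity (sw (fun a b => \sum_l c l * (f a * v l (S b)) : k^o) L).
  rewrite sw_sum; apply: eq_bigr => l _.
  by rewrite -[LHS]/(_ *: _ : k^o) -sw_scale.
apply: eq_sw_scalar => a b; rewrite mulr1 (linZ _ _ fl) /dual_int scaler_suml.
apply: eq_bigr => l _; rewrite /v -uV -scalemxAl mxtraceZ.
by rewrite [f a * _]mulrC; exact: mulrA.
Qed.

Let sum_fusion_r i j : \sum_l c l * fusion i j l = c i * c j.
Proof.
by rewrite conv_dual_int ?conv_1 ?t1 //; lin.
Qed.

(** By [fusion_flip], summing over the first index is the same expansion: the
    transposed coefficients describe multiplication by the dual of [V j]. *)
Let sum_fusion_l j l : \sum_i c i * fusion i j l = c l * v j 1.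
Proof.
transitivity (\sum_i c i * conv (conv (t l) (v j \o S)) (v i \o S) L).
  by apply: eq_bigr => i _; rewrite fusion_flip convA //; lin.
rewrite conv_dual_int; try lin.
by rewrite conv_1 ?t1 /= ?antipode1 //; lin.
Qed.

Let fusion_unit i l : fusion i ord0 l = c ord0 * (i == l)%:R.
Proof.
have E a : conv (t i) (t ord0) a = c ord0 * t i a.
  apply: (sw_epsrE (W := scalars k)
    (f := fun a => c ord0 * t i a : k^o)); first lin.
  move=> x y; rewrite -(t1 ord0) /t rho0 rho1 mul_mx_scalar mxtraceZ mulmx1.
  by rewrite mulrC -mulrA.
transitivity (c ord0 * conv (t i) (v l \o S) L).
  rewrite -[RHS]/(_ *: _ : k^o) -sw_scale; apply: eq_sw_scalar => a b.
  by rewrite E; apply/esym; apply: mulrA.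
congr (_ * _); have [<-|il] := eqVneq i l; last exact: orthogonality_neq.
by rewrite [LHS]orthogonality mulmxV ?u_unit // mul1mx weight_trace.
Qed.

Let fusion_int i j l : exists z : int, fusion i j l = z%:~R.
Proof.
have tw i' : twisted g (rho i') (u i').
  by split=> [|a b|h|]; [lin | rewrite rhoM | rewrite u_conj | rewrite cE].
have tw2 := twisted_tens comul_modular (tw i) (tw j).
have twd := twisted_dual (modular_antipodel R) (rho1 l) (tw l).
have [|||z zE] := @twisted_trace _ _ _ _ _ _ L hk _ _ _
  (twisted_tens comul_modular tw2 twd).
- exact: antipode_int R.
- by rewrite intl epsL scale1r.
- by rewrite (int_right R) counit_modular scale1r.
exists z; rewrite -zE mulmx_swl mxtrace_sw; apply: eq_sw_scalar => a b.
rewrite tensmx_mul mxtrace_tens; congr (_ * _); last first.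
  by rewrite -trmx_mul mxtrace_tr.
rewrite mulmx_swl mxtrace_sw; apply: eq_sw_scalar => x y.
by rewrite tensmx_mul mxtrace_tens; congr (_ * _); rewrite mxtrace_mulC.
Qed.

Lemma dual_int1_neq0_scaled : (dual_int 1 : k) != 0.
Proof.
have /fin_all_exists[z zE] (a : 'I_n.+1 * 'I_n.+1) :
    exists za : 'I_n.+1 -> int, forall l, fusion a.1 a.2 l = (za l)%:~R.
  by have /fin_all_exists[za zaE] l := fusion_int a.1 a.2 l; exists za.
have dual_int1E : (dual_int 1 : k) = (\sum_j c j * v j 1 : k).
  transitivity (\sum_j \tr (invmx (w j) *m rho j 1) : k); first by [].
  by apply: eq_bigr => j _; rewrite v1 rho1 mulmx1.
(* Were the value 0, [c] would lie in the kernel of the Gram matrix; but the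
   coefficients of second index 0 form a multiple of the identity matrix. *)
apply/eqP => l0; have [l||x [l xl] xz] := @gram_kernel _ hk _ _ z c.
- transitivity (\sum_i \sum_j c j * (c i * fusion i j l)).
    rewrite [RHS]pair_bigA /=; apply: eq_bigr => a _.
    transitivity (fusion a.1 a.2 l * \sum_j c j * fusion a.1 a.2 j).
      rewrite mulr_sumr; apply: eq_bigr => j _; rewrite !zE mulrC.
      by rewrite [in RHS]mulrCA [(z a l)%:~R * _]mulrC.
    by rewrite sum_fusion_r mulrC -mulrA mulrCA.
  rewrite exchange_big /=; under eq_bigr => j _ do
    rewrite -mulr_sumr sum_fusion_l mulrCA.
  by rewrite -mulr_sumr -dual_int1E l0 mulr0.
- by exists ord0.
have := xz (l, ord0); rewrite (bigD1 l) //= big1 ?addr0 => [|j jl].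
  move=> /eqP; rewrite mulf_eq0 (negPf xl) orbF intr_eq0.
  by rewrite -(pchar0_intr_eq0 hk) -zE fusion_unit eqxx mulr1
    (negPf (c_neq0 _)).
suff /eqP-> : z (l, ord0) j == 0 by rewrite mul0r.
by rewrite -(pchar0_intr_eq0 hk) -zE fusion_unit [l == j]eq_sym (negPf jl)
  mulr0.
Qed.

End Scaled.

Lemma dual_int1_neq0 : (dual_int 1 : k) != 0.
Proof.
have [c cP] := weight_scaling_exists.
by apply: (@dual_int1_neq0_scaled c) => i; have [] := cP i.
Qed.

Lemma weight_sign i : exists c : k, [/\ c != 0,
  (c *: w i) *m (c *: w i) = 1%:M & c ^+ 2 = \tr (invmx (w i))].
Proof.
have [c c0 cE] := weight_sqr_modular i; exists c.
have u2 : (c *: w i) *m (c *: w i) = 1%:M.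
  by rewrite -cE (dual_int_unimodular dual_int1_neq0) rho1.
split=> //.
have wu := weight_unit R i.
have -> : invmx (w i) = c ^+ 2 *: w i.
  rewrite -[LHS]mul1mx -u2 -scalemxAl -scalemxAr scalerA -expr2.
  by rewrite -scalemxAl mulmxK.
by rewrite mxtraceZ weight_trace mulr1.
Qed.

Lemma antipode4 h : S (S (S (S h))) = h.
Proof.
have := modular_antipode4 R h.
by rewrite (dual_int_unimodular dual_int1_neq0) mul1r mulr1.
Qed.

End Positivity.

(** * The antipode is an involution *)
(** Each term on the left is at most [m i ^ 2], while a nonzero multiple of the
    sum of these squares is at least that sum; so every term is extremal. *)
Lemma square_sum_extremal (I : finType) (m r : I -> nat) (z : int) :
    (forall i, (r i <= m i)%N) ->
    \sum_i ((r i)%:Z *+ 2 - (m i)%:Z) ^+ 2 = (\sum_i (m i)%:Z ^+ 2) * z ->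
    \sum_i ((r i)%:Z *+ 2 - (m i)%:Z) ^+ 2 != 0 ->
  forall i, (r i == 0%N) || (r i == m i).
Proof.
move=> rm E nz.
have D i : (m i)%:Z ^+ 2 - ((r i)%:Z *+ 2 - (m i)%:Z) ^+ 2 =
    (r i * (m i - r i))%N%:Z *+ 4.
  by rewrite PoszM -subzn //; ring.
set N := \sum_i (m i)%:Z ^+ 2 in E.
have N0 : 0 <= N by apply: sumr_ge0 => i _; apply: sqr_ge0.
have s0 : 0 < N * z by rewrite -E lt_def nz sumr_ge0 // => i _; apply: sqr_ge0.
have z1 : 1 <= z.
  have Npos : 0 < N by rewrite lt_def N0 andbT; apply: contraTneq s0 => ->;
    rewrite mul0r ltxx.
  by rewrite -gtz0_ge1 -(pmulr_rgt0 _ Npos).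
have : \sum_i (r i * (m i - r i))%N%:Z *+ 4 == 0.
  rewrite eq_le; apply/andP; split; last by apply: sumr_ge0.
  under eq_bigr => i _ do rewrite -D.
  by rewrite sumrB E -/N subr_le0 ler_peMr.
rewrite psumr_eq0 // => /allP E0 i; have := E0 i (mem_index_enum _).
by rewrite /= mulrn_eq0 /= eqz_nat muln_eq0 subn_eq0 => /orP[->|mr] //;
  rewrite [r i == m i]eqn_leq rm mr orbT.
Qed.

Section LarsonRadford.
Context {k : fieldType} {H : hopfAlgType k}.
Local Notation S := (@antipode k H).
Local Notation eps h := (@counit k H h : k).

Context {L : H} {n : nat} {m : 'I_n.+1 -> nat}.
Context {rho : forall i, {linear H -> 'M[k]_(m i)}}.
Hypothesis R : split_system L rho.

Let intl := sys_intl R.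
Let epsL : eps L = 1 := sys_epsL R.
Let m_gt0 := sys_dim R.
Let rhoM := sys_mul R.
Let rho1 := sys_one R.

Hypothesis hk : [pchar k] =i pred0.
Hypothesis sqrtP : forall a : k, exists c, c ^+ 2 = a.
Local Notation w := (casimir_weight R).
Local Notation dual_int := (dual_int R).
Let lin_dual_int : lin dual_int := lin_dual_int R.
Hint Resolve lin_dual_int : lindb.

Definition reg_char (h : H) : k^o := \sum_i (m i)%:R * \tr (rho i h).
Local Notation x := reg_char.

Let lin_x : lin x.
Proof. by rewrite /x; lin. Qed.
Hint Resolve lin_x : lindb.

Let x_trace a b : x (a * b) = x (b * a).
Proof. by apply: eq_bigr => i _; rewrite !rhoM mxtrace_mulC. Qed.

Let N : k := \sum_i (m i)%:R ^+ 2.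

Let x1 : x 1 = N.
Proof. by apply: eq_bigr => i _; rewrite rho1 mxtrace1 expr2. Qed.

Lemma reg_char_casimir h : x h = sw (fun a b => dual_int (S b * (h * a))) L.
Proof.
rewrite sw_sum; apply: eq_bigr => i _.
transitivity (\tr (casimir_map L rho (invmx (w i)) *m rho i h)).
  rewrite (casimir_eq R) mulVmx ?weight_unit // mxtrace1 mul_scalar_mx.
  by rewrite mxtraceZ.
rewrite mulmx_swl mxtrace_sw; apply: eq_sw_scalar => a b.
by rewrite !rhoM !mulmxA -[RHS]mxtrace_mulC !mulmxA.
Qed.

(** Tensoring with the regular representation multiplies it by the dimension.
    Applying [dual_int_left] to [S Lambda_2 h Lambda_1] gives this without any
    explicit isomorphism; the two middle legs of the integral cancel because [f]
    is a trace. *)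
Lemma conv_reg_char (f : H -> k^o) h : lin f ->
  (forall a b, f (a * b) = f (b * a)) -> conv x f h = x h * f 1.
Proof.
move=> fl ft.
transitivity (sw (fun a b =>
  sw (fun c d => dual_int c * f d : k^o) (S b * (h * a))) L).
  pose G a1 a2 b1 b2 : k^o :=
    sw (fun h1 h2 =>
      dual_int (S b2 * (h1 * a1)) * f (S b1 * (h2 * a2)) : k^o) h.
  transitivity (sw (fun a b => sw (fun b1 b2 =>
    sw (fun a1 a2 => G a1 a2 b1 b2) a) b) L).
    transitivity (sw (fun a1 y => sw (fun q b2 => sw (fun a2 b1 =>
      G a1 a2 b1 b2) q) y) L).
      transitivity (sw (fun a b => sw (fun h1 h2 =>
          dual_int (S b * (h1 * a)) * f h2 : k^o) h) L).
        rewrite -sw_exchange; apply: eq_sw_scalar => h1 h2;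
          rewrite reg_char_casimir.
        by rewrite (@sw_lin_scalar _ _ _ (fun y : k^o => (y : k) * f h2 : k^o))
          //; lin.
      apply: eq_sw_scalar => a1 y; apply/esym.
      apply: (sw_epslE (W := scalars k)
        (f := fun b2 => sw (fun h1 h2 =>
          dual_int (S b2 * (h1 * a1)) * f h2 : k^o) h)).
        by lin.
      move=> q b2.
      rewrite [X in _ *: X](_ : _ = sw (fun h1 h2 =>
        dual_int (S b2 * (h1 * a1)) * f (h2 * 1) : k^o) h); last first.
        by apply: eq_sw_scalar => h1 h2; rewrite mulr1.
      apply: (sw_SRE (W := scalars k)
        (f := fun z => sw (fun h1 h2 =>
          dual_int (S b2 * (h1 * a1)) * f (h2 * z) : k^o) h)); first lin.
      move=> a2 b1; apply: eq_sw_scalar => h1 h2; congr (_ * _).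
      by rewrite ft -mulrA.
    apply/esym; transitivity (sw (fun a b => sw (fun a1 a2 => sw (fun b1 b2 =>
      G a1 a2 b1 b2) b) a) L).
      by apply: eq_sw_scalar => a b; rewrite sw_exchange.
    rewrite sw_assoc; try (rewrite /G; lin).
    by apply: eq_sw_scalar => a1 y; rewrite -sw_assoc; try (rewrite /G; lin).
  apply: eq_sw_scalar => a b.
  rewrite (sw_mul (F := fun c d => dual_int c * f d : k^o)); try lin.
  rewrite sw_antipode; try lin.
  apply: eq_sw_scalar => b1 b2.
  rewrite (sw_mul (F := fun c d => dual_int (S b2 * c) * f (S b1 * d) : k^o));
    try lin.
  by rewrite sw_exchange.
rewrite reg_char_casimir.
transitivity (sw (fun a b => (dual_int (S b * (h * a)) * f 1 : k^o)) L).
  apply: eq_sw_scalar => a b.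
  have := congr1 f (dual_int_left R (S b * (h * a))).
  rewrite (@sw_lin_scalar _ _ _ f) // (linZ _ _ fl) => E.
  by apply: etrans E; apply: eq_sw_scalar => c d; rewrite (linZ _ _ fl).
by rewrite (@sw_lin_scalar _ _ _ (fun y : k^o => (y : k) * f 1 : k^o)) //; lin.
Qed.

Definition reg_conv : 'End(H) :=
  linfun (tlift (fun a b => (x a : k) *: b) \o @comul k H).
Local Notation P := reg_conv.

Let lin_P : lin P.
Proof. by move=> c u v; rewrite linearP. Qed.
Hint Resolve lin_P : lindb.

Let PE h : P h = sw (fun a b => (x a : k) *: b) h.
Proof. by rewrite /reg_conv lfunE. Qed.

Let reg_op2 h : P (P h) = N *: P h.
Proof.
rewrite [P h]PE (sw_lin _ _ lin_P) -sw_scale.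
transitivity (sw (fun a b =>
  sw (fun c d => (x a : k) *: ((x c : k) *: d)) b) h).
  by apply: eq_sw => a b; rewrite (linZ _ _ lin_P) PE sw_scale.
rewrite -sw_assoc; try lin; apply: eq_sw => a b.
transitivity ((conv x x a : k) *: b).
  rewrite (@sw_lin _ _ _ _ (fun y : k^o => (y : k) *: b)); try lin.
  by apply: eq_sw => c d; rewrite scalerA.
by rewrite conv_reg_char // x1 scalerA mulrC.
Qed.

Let x_antipode2 a : x (S (S a)) = x a.
Proof.
apply: eq_bigr => i _; congr (_ * _).
rewrite -[rho i (S (S a))](mulmxK (weight_unit R i)) -weight_antipode2.
by rewrite mxtrace_mulC mulKmx ?weight_unit.
Qed.

Let reg_op_antipode2 h : P (S (S h)) = S (S (P h)).
Proof.
rewrite !PE !sw_antipode; try lin.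
rewrite (@sw_lin _ _ _ _ (fun y => S (S y))); try lin.
by apply: eq_sw => a b; rewrite x_antipode2 !linearZ.
Qed.

(** [Lambda_1] and [S Lambda_2] are dual bases for [dual_int]. *)
Lemma trace_formula (F : 'End(H)) :
  \tr (mxof (vbasis {:H}) (vbasis {:H}) F) =
  sw (fun a b => dual_int (S b * F a)) L.
Proof.
set e := vbasis {:H}; have eb : basis_of {:H} e := vbasisP _.
transitivity (\sum_i coord e i (F e`_i)).
  by apply: eq_bigr => i _; rewrite !mxE /= vecof_delta.
transitivity (sw (fun a b => \sum_i (coord e i (F a) * dual_int (S b * e`_i)) :
  k^o) L).
  rewrite sw_sum; apply: eq_bigr => i _.
  rewrite -[in LHS](dual_basis_r R e`_i).
  have cl : lin (fun y => coord e i (F y) : k^o) by move=> c u v;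
    rewrite !linearP.
  rewrite (@sw_lin_scalar _ _ _ (fun y => coord e i (F y)) _ _ cl).
  by apply: eq_sw_scalar => a b; rewrite !linearZ; exact: mulrC.
apply: eq_sw_scalar => a b.
rewrite [in RHS](coord_basis eb (memvf (F a))) mulr_sumr (lin_bigsum _ _ _
  lin_dual_int).
by apply: eq_bigr => i _; rewrite -scalerAr (linZ _ _ lin_dual_int).
Qed.

Let xL : x L = 1.
Proof.
rewrite reg_char_casimir.
transitivity (sw (fun a b => eps b *: (@counit k H a)) L).
  apply: eq_sw_scalar => a b; rewrite (int_right R) -scalerAr.
  have -> : S b * L = eps b *: L by have := intl (S b); rewrite counit_antipode.
  by rewrite scalerA (linZ _ _ lin_dual_int) dual_int_L [LHS]mulr1 mulrC.
rewrite (@sw_epsr _ _ (scalars k)) //; lin.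
Qed.

Let trace_op : sw (fun a b => dual_int (S b * S (S (P a)))) L = dual_int 1.
Proof.
transitivity (sw (fun z t => sw (fun y b =>
   x z * dual_int (S b * S (S y)) : k^o) t) L).
  rewrite -sw_assoc; try lin; apply: eq_sw_scalar => a b.
  rewrite PE (@sw_lin_scalar _ _ _ (fun y => dual_int (S b * S (S y))));
    try lin.
  by apply: eq_sw_scalar => c d; rewrite !linearZ -scalerAr (linZ _ _
    lin_dual_int).
rewrite -[RHS]mul1r -xL [RHS]mulrC.
rewrite -[RHS]/((fun y => dual_int 1 *: x y) L).
apply: (sw_epsrE (W := scalars k)
  (f := fun y => dual_int 1 *: x y)); first lin.
move=> z t; rewrite [X in _ *: X](_ : _ = x z * dual_int (S 1)); last first.
  by rewrite antipode1; exact: mulrC.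
apply: (sw_SLE (W := scalars k)
  (f := fun y => x z * dual_int (S y) : k^o)); first lin.
by move=> y b; rewrite antipodeM.
Qed.

Let N_nat : N = (\sum_i (m i)%:Z ^+ 2)%:~R.
Proof. by rewrite rmorph_sum; apply: eq_bigr => i _;
  rewrite rmorphXn /= -pmulrn. Qed.

Let N_neq0 : N != 0.
Proof.
rewrite N_nat pchar0_intr_eq0 // psumr_eq0 => [|i _]; last exact: sqr_ge0.
apply/allPn; exists ord0; first exact: mem_index_enum.
by rewrite expf_eq0 /= eqz_nat -lt0n m_gt0.
Qed.

(** The square of the antipode times [P], divided by [N], is an involution on
    the image of the idempotent [P] divided by [N]; its trace is an integer. *)
Lemma dual_int1_multiple : exists z : int, (dual_int 1 : k) = N * z%:~R.
Proof.
set e := vbasis {:H}; have eb : basis_of {:H} e := vbasisP _.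
have [F FE] : exists F : 'End(H), forall h, F h = S (S (P h)).
  exists (linfun S \o (linfun S \o reg_conv))%VF => h.
  by rewrite !comp_lfunE !(lfunE S).
have F3 : (F \o F \o F)%VF = N ^+ 2 *: F.
  apply/lfunP => h; rewrite scale_lfunE !comp_lfunE !FE !reg_op_antipode2
    !reg_op2.
  rewrite !linearZ /= scalerA -expr2.
  by rewrite !(antipode4 R hk sqrtP).
have M3 : N^-1 *: mxof e e F *m (N^-1 *: mxof e e F) *m (N^-1 *: mxof e e F) =
    N^-1 *: mxof e e F.
  rewrite -mulmxA -!scalemxAl -!scalemxAr !scalerA -!mxof_comp // F3 linearZ /=.
  by rewrite scalerA; congr (_ *: _); field.
have [z zE] := mxtrace_cube hk M3; exists z.
rewrite -zE mxtraceZ trace_formula mulVKf // -trace_op.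
by apply: eq_sw_scalar => a b; rewrite FE.
Qed.

(** The rescaled weight is an involution of trace [r *+ 2 - m], where [r] is the
    multiplicity of the eigenvalue 1. *)
Theorem weight_scalar i : w i = (m i)%:R^-1%:M.
Proof.
have /fin_all_exists[c cP] j := weight_sign R hk sqrtP j.
have /fin_all_exists[r rP] j : exists r : nat, [/\ (r <= m j)%N,
    c j = r%:R *+ 2 - (m j)%:R &
    (r == 0%N) || (r == m j) -> exists a, c j *: w j = a%:M].
  have [_ u2 _] := cP j; have [r rm [trE ra]] := mxtrace_invol hk u2.
  exists r; split=> //; by rewrite -trE mxtraceZ weight_trace mulr1.
have [z zE] := dual_int1_multiple.
have sumE : \sum_i ((r i)%:Z *+ 2 - (m i)%:Z) ^+ 2 =
    (\sum_i (m i)%:Z ^+ 2) * z.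
  apply/eqP; rewrite -subr_eq0 -(pchar0_intr_eq0 hk) rmorphB rmorphM /= -N_nat.
  rewrite -zE subr_eq0 rmorph_sum; apply/eqP/eq_bigr => j _.
  have [_ cE _] := rP j; have [_ _ c2] := cP j.
  by rewrite rho1 mulmx1 -c2 cE rmorphXn rmorphB rmorphMn /= -!pmulrn.
have rm j : (r j <= m j)%N by have [] := rP j.
have sn0 : \sum_i ((r i)%:Z *+ 2 - (m i)%:Z) ^+ 2 != 0.
  rewrite sumE -(pchar0_intr_eq0 hk) rmorphM /= -N_nat -zE.
  exact: dual_int1_neq0 R hk sqrtP.
have ext := square_sum_extremal rm sumE sn0.
have [_ _ /(_ (ext i)) [a aE]] := rP i; have [c0 _ _] := cP i.
have wE : w i = ((c i)^-1 * a)%:M.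
  by rewrite -scale_scalar_mx -aE scalerA mulVf // scale1r.
have m0 : (m i)%:R != 0 :> k by move/pcharf0P: hk => ->; rewrite -lt0n m_gt0.
have := weight_trace R i; rewrite wE mxtrace_scalar => E.
by congr (_%:M); apply: (mulIf m0); rewrite mulr_natr E mulVf.
Qed.

Theorem antipode2 h : S (S h) = h.
Proof.
apply: (rho_inj R) => i; apply: (can_inj (mulmxK (weight_unit R i))).
by rewrite -weight_antipode2 weight_scalar mul_scalar_mx mul_mx_scalar.
Qed.
End LarsonRadford.

(** * Modules as matrix representations *)
Section ModuleMatrix.
Context {k : fieldType} {H : falgType k}.
Implicit Types M N : hmodule H.

Local Notation bs M := (vbasis {:carrier M}).

(** The transpose compensates for [mxof] acting on row vectors, which reverses
    composition. *)
Definition mxrep M (h : H) : 'M[k]_(\dim {:M}) :=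
  (mxof (bs M) (bs M) (act M h))^T.

Fact mxrep_is_linear M : linear (mxrep M).
Proof. by move=> a g h; rewrite /mxrep !linearP. Qed.
HB.instance Definition _ M :=
  GRing.isSemilinear.Build k H 'M[k]_(\dim {:M}) _ (mxrep M)
    (GRing.semilinear_linear (mxrep_is_linear M)).

Lemma mxrep_mul M g h : mxrep M (g * h) = mxrep M g *m mxrep M h.
Proof.
rewrite /mxrep actM (mxof_comp _ _ (vbasisP _)).
by rewrite trmx_mul.
Qed.

Lemma mxrep_id M h : act M h = \1%VF -> mxrep M h = 1%:M.
Proof. by move=> E; rewrite /mxrep E (mxof1 (basis_free (vbasisP _))) trmx1.
  Qed.

Lemma mxrep_one M : mxrep M 1 = 1%:M.
Proof. by apply: mxrep_id; rewrite act1. Qed.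

Lemma mxrep_eq0 M h : mxrep M h = 0 -> act M h = 0.
Proof.
move=> E; apply/eqP; rewrite -(mxof_eq0 (vbasisP _) (vbasisP _)).
by rewrite -[mxof _ _ _]trmxK -/(mxrep M h) E trmx0.
Qed.

(** The kernel of [f] is a submodule as soon as [f] intertwines the action of
    each [h] with some endomorphism of the target. *)
Lemma schur_ker M N (f : 'Hom(M, N)) :
    (forall h, exists C : 'End(N), (f \o act M h)%VF = (C \o f)%VF) ->
  irreducible M -> f != 0 -> lker f == 0%VS.
Proof.
move=> fC [_ irr] f0; have [h|->//|kf] := irr (lker f).
  apply/subvP => _ /memv_imgP[x xk ->]; rewrite memv_ker.
  have [C fE] := fC h; rewrite -comp_lfunE fE comp_lfunE.
  by move: xk; rewrite memv_ker => /eqP ->; rewrite linear0.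
case/eqP: f0; apply/lfunP => x; rewrite zero_lfunE; apply/eqP.
by rewrite -memv_ker kf memvf.
Qed.

Lemma schur_iso M N (f : 'Hom(M, N)) :
    (forall h, (f \o act M h)%VF = (act N h \o f)%VF) ->
  irreducible M -> irreducible N -> f != 0 -> isomorphic M N.
Proof.
move=> fC irrM irrN f0.
have kf : lker f == 0%VS.
  by apply: schur_ker => // h; exists (act N h).
have lf : limg f = fullv.
  have [_ irr] := irrN; have [h|lf|//] := irr (limg f).
    apply/subvP => _ /memv_imgP[_ /memv_imgP[x _ ->] ->].
    by rewrite -comp_lfunE -fC comp_lfunE memv_img ?memvf.
  case/eqP: f0; apply/lfunP => x; rewrite zero_lfunE; apply/eqP.
  by rewrite -memv0 -lf memv_img ?memvf.
exists f => //; exists (f^-1)%VF; first exact: lker0_lfunK.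
by move=> y; apply: limg_lfunVK; rewrite lf memvf.
Qed.

Lemma mxrep_schur_iso M N (X : 'M_(\dim {:N}, \dim {:M})) :
    irreducible M -> irreducible N -> X != 0 ->
    (forall h, mxrep N h *m X = X *m mxrep M h) ->
  isomorphic M N.
Proof.
move=> irrM irrN X0 XC.
have eM : basis_of {:carrier M} (bs M) := vbasisP _.
have eN : basis_of {:carrier N} (bs N) := vbasisP _.
apply: (@schur_iso _ _ (hommx (bs M) (bs N) X^T)) => //.
  move=> h; apply: (can_inj (mxofK (vbasisP _) (vbasisP _))).
  rewrite (mxof_comp _ _ eM) (mxof_comp _ _ eN) !hommxK //; apply: trmx_inj.
  by rewrite !trmx_mul trmxK; apply/esym/XC.
by rewrite hommx_eq0 // -(inj_eq trmx_inj) trmxK trmx0.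
Qed.

Lemma mxrep_irr_unit M (B : 'M_(\dim {:M})) :
    irreducible M -> B != 0 ->
    (forall h, exists C, B *m mxrep M h = C *m B) -> B \in unitmx.
Proof.
move=> irrM B0 BC; rewrite -unitmx_tr -row_free_unit -kermx_eq0.
have eb : basis_of {:carrier M} (bs M) := vbasisP _.
rewrite -[B^T](hommxK eb eb) -(vsof_eq0 eb) -lker_ker //.
apply: schur_ker irrM _ => [h|]; last first.
  by rewrite hommx_eq0 // -(inj_eq trmx_inj) trmxK trmx0.
have [C CE] := BC h; exists (hommx (bs M) (bs M) C^T).
apply: (can_inj (mxofK eb eb)); rewrite !(mxof_comp _ _ eb) !hommxK //.
by apply: trmx_inj; rewrite !trmx_mul !trmxK.
Qed.

End ModuleMatrix.

Section LeftIdeal.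
Context {k : fieldType} {H : falgType k}.
Variables (I : {vspace H}) (leftI : left_ideal I).

Let memI h x : x \in I -> h * x \in I.
Proof. by move=> xI; apply: (subvP leftI); rewrite memv_mul ?memvf. Qed.

Definition ideal_act (h : H) : 'End(subvs_of I) :=
  (linfun (vsproj I) \o amull h \o linfun vsval)%VF.

Let ideal_actE h x : vsval (ideal_act h x) = h * vsval x.
Proof. by rewrite !comp_lfunE !lfunE /= vsprojK // memI ?subvsP. Qed.

Fact ideal_act_is_linear : linear ideal_act.
Proof.
move=> a g h; apply/lfunP => x; apply: subvs_inj.
rewrite add_lfunE scale_lfunE linearP /= !ideal_actE.
by rewrite mulrDl scalerAl.
Qed.
HB.instance Definition _ :=
  GRing.isSemilinear.Build k H 'End(subvs_of I) _ ideal_act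
    (GRing.semilinear_linear ideal_act_is_linear).

Fact ideal_act1 : ideal_act 1 = \1%VF.
Proof.
by apply/lfunP => x; apply: subvs_inj; rewrite ideal_actE id_lfunE mul1r.
Qed.

Fact ideal_actM g h : ideal_act (g * h) = (ideal_act g \o ideal_act h)%VF.
Proof.
by apply/lfunP => x; apply: subvs_inj; rewrite comp_lfunE !ideal_actE mulrA.
Qed.

Definition ideal_module : hmodule H := HModule ideal_act1 ideal_actM.

End LeftIdeal.

Section Faithful.
Context {k : fieldType} {H : falgType k}.
Hypothesis ssH : semisimple H.
Variables (n : nat) (V : 'I_n.+1 -> hmodule H).
Hypothesis hV : complete_irreducibles V.

Let annihilated (I : {vspace H}) :=
  forall h i, h \in I -> act (V i) h = 0.

(** A minimal nonzero left ideal is an irreducible module, so if all irreducible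
    modules are killed by it then it has square zero;
      but a complement of it gives
    a right identity inside it. *)
Let annihilated_ideal0 d (I : {vspace H}) :
  left_ideal I -> annihilated I -> (\dim I <= d)%N -> I = 0%VS.
Proof.
elim: d I => [|d IHd] I leftI annI dI.
  by apply/eqP; rewrite -dimv_eq0 -leqn0.
have [//|I0] := eqVneq I 0%VS.
pose M := ideal_module leftI.
have actE h (x : M) : vsval (act M h x) = h * vsval x.
  rewrite /= !comp_lfunE !lfunE /= vsprojK //.
  by apply: (subvP leftI); rewrite memv_mul ?memvf ?subvsP.
have iota_ker : lker (linfun (vsval : subvs_of I -> H)) == 0%VS.
  by apply/lker0P => x y; rewrite !lfunE; apply: subvs_inj.
have dimM (U : {vspace subvs_of I}) : \dim (linfun vsval @: U)%VS = \dim U.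
  by apply: limg_dim_eq; rewrite (eqP iota_ker) capv0.
have imgM : (linfun vsval @: {: subvs_of I})%VS = I.
  apply/vspaceP => x; apply/memv_imgP/idP => [[y _ ->]|xI].
    by rewrite lfunE subvsP.
  by exists (vsproj I x); rewrite ?memvf // lfunE /= vsprojK.
have irrM : irreducible M.
  split=> [|U stU]; first by rewrite -dimM imgM lt0n dimv_eq0.
  pose J := (linfun (vsval : subvs_of I -> H) @: U)%VS.
  have JI : (J <= I)%VS by rewrite -imgM limgS // subvf.
  have leftJ : left_ideal J.
    apply/prodvP => h _ _ /memv_imgP[x xU ->].
    have -> : h * linfun vsval x = linfun vsval (act M h x).
      rewrite [in LHS]lfunE [in RHS]lfunE; exact/esym/actE.
    by apply/memv_img/(subvP (stU h)); rewrite memv_img.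
  have [dJ|dJ] := leqP (\dim I) (\dim J).
    right; apply/eqP; rewrite -dimv_leqif_eq ?subvf //.
    by rewrite -!dimM imgM eqn_leq dJ dimvS.
  left; apply/eqP; rewrite -dimv_eq0 -dimM -/J dimv_eq0; apply/eqP.
  apply: IHd => //; last by rewrite -ltnS (leq_trans dJ).
  by move=> h i hJ; apply: annI; apply: (subvP JI).
have [_ _ /(_ M irrM) [i [f fbij fC]]] := hV.
have annM h x : h \in I -> x \in I -> h * x = 0.
  move=> hI xI; have f0 : f (act M h (vsproj I x)) = 0.
    by rewrite -comp_lfunE fC annI // comp_lfun0l zero_lfunE.
  have M0 : act M h (vsproj I x) = 0 by apply: (bij_inj fbij); rewrite linear0.
  by have := actE h (vsproj I x); rewrite M0 vsprojK // linear0.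
have [J [leftJ IJ1 IJ0]] := ssH leftI.
have : 1 \in (I + J)%VS by rewrite IJ1 memvf.
case/memv_addP => e eI [e' e'J E].
apply/eqP; rewrite -subv0; apply/subvP => x xI; rewrite -IJ0 memv_cap xI.
have -> : x = x * e' by rewrite -[LHS]mulr1 E mulrDr annM // add0r.
by apply: (subvP leftJ); rewrite memv_mul ?memvf.
Qed.

(** The common annihilator of the irreducible modules is a left ideal. *)
Lemma mxrep_faithful h : (forall i, mxrep (V i) h = 0) -> h = 0.
Proof.
move=> h0.
pose I := (\bigcap_i lker (linfun (act (V i))))%VS.
have memI x : reflect (forall i, act (V i) x = 0) (x \in I).
  apply: (iffP idP) => [xI i|x0].
    have /subv_bigcapP/(_ i isT)/subvP/(_ x xI) := subvv I.
    by rewrite memv_ker lfunE => /eqP.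
  rewrite memvE; apply/subv_bigcapP => i _.
  by rewrite -memvE memv_ker lfunE /= x0.
have I0 : I = 0%VS.
  apply: annihilated_ideal0 (leqnn _).
    apply/prodvP => g x _ /memI x0; apply/memI => i.
    by rewrite actM x0 comp_lfun0r.
  by move=> x i /memI.
apply/eqP; rewrite -memv0 -I0; apply/memI => i.
exact: mxrep_eq0.
Qed.

End Faithful.

Lemma mx_dim1_scalar (k : fieldType) m (A : 'M[k]_m) : m = 1%N -> A =
  (\tr A)%:M.
Proof. by move=> m1; subst m; rewrite trace_mx11 -mx11_scalar. Qed.

Section ModuleSystem.
Context {k : closedFieldType} {H : hopfAlgType k}.
Hypothesis hk : [pchar k] =i pred0.
Hypothesis ssH : semisimple H.
Variables (L : H) (hL : idempotent_integral L).
Variables (n : nat) (V : 'I_n.+1 -> hmodule H).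
Hypothesis hV : complete_irreducibles V.
Hypothesis hV0 : character (V ord0) = linfun (@counit k H).

Lemma characterE (M : hmodule H) h : character M h = \tr (mxrep M h).
Proof.
rewrite /character lfunE /= mxtrace_tr //.
Qed.

Lemma mxrep_system : split_system L (fun i => mxrep (V i)).
Proof.
have [intL L0 LL] := hL; have [irrV injV _] := hV.
have unitV i (B : 'M_(\dim {:V i})) : B != 0 ->
    (forall h, exists C, B *m mxrep (V i) h = C *m B) -> B \in unitmx.
  exact: mxrep_irr_unit.
split=> //.
- have : ((counit L : k) - 1) *: L == 0.
    by rewrite scalerBl -intL LL scale1r subrr.
  by rewrite scaler_eq0 (negPf L0) orbF subr_eq0 => /eqP.
- by move=> i; case: (irrV i).
- by move=> i g h; apply: mxrep_mul.
- by move=> i; apply: mxrep_one.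
- exact: mxrep_faithful.
- move=> i j X ij XC; apply/eqP; apply: contraNT ij => X0.
  by apply/eqP/esym/injV; apply: mxrep_schur_iso XC.
- move=> i X XC.
  have [a] : exists a, root (char_poly X) a.
    by apply/closed_rootP; rewrite size_char_poly eqSS -lt0n; case: (irrV i).
  rewrite -eigenvalue_root_char /eigenvalue /eigenspace kermx_eq0.
  rewrite row_free_unit => Xa; exists a; apply/eqP; rewrite -subr_eq0.
  apply: contraNT Xa => Xa; apply: (unitV i) => // h; exists (mxrep (V i) h).
  by rewrite mulmxBl mulmxBr XC scalar_mxC.
- move=> h; have d0 : \dim {:V ord0} = 1%N.
    have /(congr1 (fun f : 'Hom(H, k^o) => f 1)) := hV0.
    rewrite characterE mxrep_one mxtrace1 lfunE /= counit1 => /eqP.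
    have /pcharf0P ch := hk; have := irrV ord0; case=> dpos _.
    by rewrite -(prednK dpos) -natr1 -subr_eq0 addrK ch => /eqP ->.
  rewrite [LHS]mx_dim1_scalar // -characterE hV0 lfunE //.
Qed.

End ModuleSystem.

(** * Rational elements in characteristic zero *)
Section Rational.
Context {k : fieldType}.
Hypothesis hk : [pchar k] =i pred0.

Let intr_neq0 (z : int) : z != 0 -> z%:~R != 0 :> k.
Proof. by rewrite pchar0_intr_eq0. Qed.

(** Characteristic zero makes all denominators invertible, so [ratr] is a ring
    morphism into [k] although [k] carries no order. *)
Lemma ratr_frac (a b : int) : b != 0 ->
  ratr (a%:~R / b%:~R : rat) = a%:~R / b%:~R :> k.
Proof.
move=> b0; set x : rat := _ / _.
have E : numq x * b = a * denq x.
  apply/eqP; rewrite -(eqr_int rat) !rmorphM /=.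
  have bq : b%:~R != 0 :> rat by rewrite intr_eq0.
  have dq : (denq x)%:~R != 0 :> rat by rewrite intr_eq0 denq_neq0.
  by rewrite -(eqr_div _ _ dq bq) divq_num_den.
apply/eqP; rewrite /ratr eqr_div ?intr_neq0 ?denq_neq0 //.
by rewrite -!rmorphM /= E.
Qed.

Let fracE (x : rat) : x = (numq x)%:~R / (denq x)%:~R.
Proof. by rewrite divq_num_den. Qed.

Let nz (x : rat) : (denq x)%:~R != 0 :> k.
Proof. by rewrite intr_neq0 ?denq_neq0. Qed.

Let nzq (x : rat) : (denq x)%:~R != 0 :> rat.
Proof. by rewrite intr_eq0 denq_neq0. Qed.

Let den2 (x y : rat) : denq x * denq y != 0.
Proof. by rewrite mulf_neq0 ?denq_neq0. Qed.

Lemma ratrD_pchar0 (x y : rat) : ratr (x + y) = ratr x + ratr y :> k.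
Proof.
rewrite {1}(fracE x) {1}(fracE y) addf_div ?nzq //.
rewrite -!rmorphM -rmorphD /= ratr_frac ?den2 //.
by rewrite rmorphD !rmorphM /= -addf_div ?nz.
Qed.

Lemma ratrM_pchar0 (x y : rat) : ratr (x * y) = ratr x * ratr y :> k.
Proof.
rewrite {1}(fracE x) {1}(fracE y) mulf_div -!rmorphM /= ratr_frac ?den2 //.
by rewrite !rmorphM /= -mulf_div.
Qed.

Lemma nonneg_rational_nat_div (a b : nat) : nonneg_rational (a%:R / b%:R : k).
Proof.
case: b => [|b].
  by exists 0; rewrite // invr0 mulr0; exact/esym/(ratr_nat k 0).
exists ((a%:Z)%:~R / (b.+1%:Z)%:~R); first by rewrite divr_ge0 ?ler0z.
by rewrite ratr_frac // -!pmulrn.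
Qed.

Lemma nonneg_rationalD (x y : k) :
  nonneg_rational x -> nonneg_rational y -> nonneg_rational (x + y).
Proof.
move=> [p p0 ->] [q q0 ->]; exists (p + q); first exact: addr_ge0.
by rewrite ratrD_pchar0.
Qed.

Lemma nonneg_rationalM (x y : k) :
  nonneg_rational x -> nonneg_rational y -> nonneg_rational (x * y).
Proof.
move=> [p p0 ->] [q q0 ->]; exists (p * q); first exact: mulr_ge0.
by rewrite ratrM_pchar0.
Qed.

Lemma nonneg_rational_sum (I : Type) (r : seq I) (P : pred I) (F : I -> k) :
  (forall i, P i -> nonneg_rational (F i)) ->
  nonneg_rational (\sum_(i <- r | P i) F i).
Proof.
move=> F0; apply: big_ind => //; last exact: nonneg_rationalD.
by have := nonneg_rational_nat_div 0 1; rewrite mul0r.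
Qed.

Lemma pos_rational_1D (x : k) : nonneg_rational x -> pos_rational (1 + x).
Proof.
move=> [q q0 ->]; exists (1 + q); first by rewrite ltr_pwDl.
by rewrite ratrD_pchar0 (ratr_nat k 1).
Qed.

Lemma nonneg_rational_mxpow n (A : 'M[k]_n.+1) m :
    (forall i j, nonneg_rational (A i j)) ->
  forall i j, nonneg_rational ((A ^+ m) i j).
Proof.
move=> A0; elim: m => [|m IHm] i j.
  rewrite expr0 mxE; case: (i == j).
    by have := nonneg_rational_nat_div 1 1; rewrite divr1.
  by have := nonneg_rational_nat_div 0 1; rewrite mul0r.
rewrite exprS mxE; apply: nonneg_rational_sum => l _.
exact: nonneg_rationalM.
Qed.

End Rational.

(** * Central idempotents and adjoint characters *)
Section AdjointCharacters.
Context {k : fieldType} {H : hopfAlgType k}.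
Local Notation S := (@antipode k H).
Local Notation eps h := (@counit k H h : k).

Context {L : H} {n : nat} {m : 'I_n.+1 -> nat}.
Context {rho : forall i, {linear H -> 'M[k]_(m i)}}.
Hypothesis R : split_system L rho.

Let epsL : eps L = 1 := sys_epsL R.
Let m_gt0 := sys_dim R.
Let rhoM := sys_mul R.
Let rho1 := sys_one R.
Let schur_eq := sys_schur_eq R.
Let rho0 := sys_trivial R.

Hypothesis hk : [pchar k] =i pred0.
Hypothesis sqrtP : forall a : k, exists c, c ^+ 2 = a.

Let d i : k := (m i)%:R.
Let chi i (h : H) : k^o := \tr (rho i h).

Let d_neq0 i : d i != 0.
Proof. by have /pcharf0P := hk; rewrite /d => ->; rewrite -lt0n m_gt0. Qed.

Let lin_chi i : lin (chi i). Proof. by rewrite /chi; lin. Qed.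
Let lin_chiS i : lin (chi i \o S).
Proof. exact: (lin_app (lin_chi i) (lin_lfun S (@lin_id _ _))). Qed.
Hint Resolve lin_chi lin_chiS lin_conv : lindb.

Let chi_trace i a b : chi i (a * b) = chi i (b * a).
Proof. by rewrite /chi !rhoM mxtrace_mulC. Qed.

Let SS := antipode2 R hk sqrtP.

(** The unit of the block of [V i]. *)
Definition central_unit i : H :=
  d i *: sw (fun a b => (chi i (S b) : k) *: a) L.
Local Notation F := central_unit.

Lemma rho_central_unit i j : rho j (F i) = if j == i then 1%:M else 0.
Proof.
apply: mxtrace_nondeg => A; rewrite linearZ -scalemxAr mxtraceZ.
rewrite (@sw_lin_scalar _ _ _ (fun x => \tr (A *m rho j x) : k^o)); try lin.
transitivity (d i * sw (fun a b =>
    \tr (A *m rho j a) * \tr (1%:M *m rho i (S b)) : k^o) L).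
  congr (_ * _); apply: eq_sw_scalar => a b.
  by rewrite linearZ -scalemxAr mxtraceZ mul1mx mulrC.
have [ji|ji] := eqVneq j i; last first.
  by rewrite orthogonality_neq // mulr0 mulmx0 mxtrace0.
subst j; rewrite orthogonality mulmx1 (weight_scalar R hk sqrtP) mul_mx_scalar
  mxtraceZ.
by rewrite mulVKf // mulmx1.
Qed.

Definition ad_char i : H -> k^o := conv (chi i) (chi i \o S).

Lemma lin_ad_char i : lin (ad_char i). Proof. exact: lin_conv. Qed.
Hint Resolve lin_ad_char : lindb.

Lemma ad_central_unit i j :
  ad_char i (F j) = d j * conv (ad_char i) (chi j \o S) L.
Proof.
rewrite /central_unit (linZ _ _ (lin_ad_char i)); congr (_ * _).
rewrite (@sw_lin_scalar _ _ _ (ad_char i)); try lin.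
by apply: eq_sw_scalar => a b; rewrite (linZ _ _ (lin_ad_char i)); exact: mulrC.
Qed.

(** The left side counts the invariants of [End (V i)], which are the scalars by
    Schur's lemma. *)
Lemma ad_int i : ad_char i L = 1.
Proof.
transitivity (sw (fun a b =>
    \tr (1%:M *m rho i a) * \tr (1%:M *m rho i (S b)) : k^o) L).
  by apply: eq_sw_scalar => a b; rewrite !mul1mx.
by rewrite orthogonality !mul1mx weight_trace.
Qed.

(** The matrix by which the idempotent [F j] acts on the tensor product of [V i]
    with its dual is idempotent. *)
Lemma ad_nat i j : exists r : nat, ad_char i (F j) = r%:R :> k.
Proof.
have tw : twisted 1 (rho i) 1%:M.
  split=> [|a b|h|]; [by lin | by rewrite rhoM | | by rewrite rho1 mulmx1].
  by rewrite SS mulmx1 mul1mx.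
have c1 := @comul1 k H.
have S11 : S 1 * 1 = 1 :> H by rewrite mulr1 antipode1.
have [l2 m2 _ _] := twisted_tens c1 tw (twisted_dual S11 (rho1 i) tw).
pose X := sw (fun a b => rho i a *t (rho i (S b))^T) (F j).
have FF : F j * F j = F j.
  apply: (rho_inj R) => p; rewrite rhoM rho_central_unit.
  by case: ifP; rewrite ?mul1mx // mul0mx.
have E : \tr X = (\rank X)%:R by apply: mxtrace_idem; rewrite /X -m2 FF.
exists (\rank X); apply: etrans E.
rewrite mxtrace_sw; apply: eq_sw_scalar => a b.
by rewrite mxtrace_tens mxtrace_tr.
Qed.

Let chi0 h : chi ord0 h = d ord0 * eps h.
Proof. by rewrite /chi rho0 mxtrace_scalar -[LHS]mulr_natr mulrC. Qed.

Let d0 : d ord0 * d ord0 = 1.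
Proof.
rewrite -(ad_int ord0) /ad_char /conv.
transitivity (d ord0 * d ord0 * eps L); first by rewrite epsL mulr1.
apply/esym.
apply: (sw_epsrE (W := scalars k)
  (f := fun h => d ord0 * d ord0 * eps h : k^o)); first lin.
move=> a b; rewrite /= !chi0 counit_antipode mulrACA.
by rewrite [eps a * _]mulrC mulrCA.
Qed.

Lemma ad_trivial h : ad_char ord0 h = eps h.
Proof.
apply: (sw_epsrE (W := scalars k)
  (f := @counit k H)); first lin.
move=> a b; rewrite /= !chi0 counit_antipode mulrACA d0 mul1r.
by rewrite [LHS]mulrC.
Qed.

Definition central (z : H) := forall h, h * z = z * h.

(** Centrality of [z] lets the coproduct of [h] change sides; what remains is
    [h_3 S h_2], which collapses because the antipode is an involution. *)
Lemma partial_trace_central i z : central z ->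
  central (sw (fun a b => (chi i (S b) : k) *: a) z).
Proof.
move=> zC h.
rewrite (@sw_lin _ _ _ _ (fun x => h * x)); try lin.
rewrite (@sw_lin _ _ _ _ (fun x => x * h)); try lin.
transitivity (sw (fun h1 h' => sw (fun h2 h3 => sw (fun a b =>
    (chi i (S (h2 * b) * h3) : k) *: (h1 * a)) z) h') h).
  apply/esym.
  apply: (sw_epsrE (f := fun x => sw (fun a b => x * ((chi i (S b) : k) *: a))
    z)).
    by lin.
  move=> h1 h'.
  transitivity (eps h' *: sw (fun a b => (chi i (S b * 1) : k) *: (h1 * a)) z).
    apply: (sw_SLE (f := fun x => sw (fun a b => (chi i (S b * x) : k) *: (h1 *
      a)) z)).
      by lin.
    by move=> h2 h3; apply: eq_sw => a b; rewrite antipodeM mulrA.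
  by congr (_ *: _); apply: eq_sw => a b; rewrite mulr1 scalerAr.
rewrite -sw_assoc; try lin.
transitivity (sw (fun h' h3 => sw (fun a b => sw (fun h1 h2 =>
    (chi i (S (b * h2) * h3) : k) *: (a * h1)) h') z) h).
  apply: eq_sw => h' h3.
  rewrite -(sw_mul (F := fun a b => (chi i (S b * h3) : k) *: a)); try lin.
  by rewrite zC sw_mul; try lin.
transitivity (sw (fun a b => sw (fun h' h3 => sw (fun h1 h2 =>
    (chi i (S (b * h2) * h3) : k) *: (a * h1)) h') h) z).
  by rewrite sw_exchange.
apply: eq_sw => a b; rewrite sw_assoc; try lin.
apply: (sw_epsrE (f := fun x => (chi i (S b) : k) *: a * x)); first lin.
move=> h1 h'.
transitivity (eps h' *: ((chi i (S b * S 1) : k) *: (a * h1))); last first.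
  by rewrite antipode1 mulr1 scalerAl.
apply: (sw_SRE (f := fun x => (chi i (S b * S x) : k) *: (a * h1))); first lin.
move=> h2 h3; congr (_ *: _).
by rewrite !antipodeM SS -mulrA chi_trace -!mulrA.
Qed.

Lemma rho_brace i z :
  rho i (brace z L) =
  (d i)^-1 *: rho i (sw (fun a b => (chi i (S b) : k) *: a) z).
Proof.
rewrite /brace -/(sw _ _).
rewrite (@sw_lin _ _ _ _ (rho i)); try lin.
rewrite (@sw_lin _ _ _ _ (rho i)); try lin.
rewrite -sw_scale; apply: eq_sw => a b.
transitivity (rho i a *m casimir_map L rho (rho i (S b))).
  rewrite mulmx_swr -/(sw _ _) (@sw_lin _ _ _ _ (rho i)); try lin.
  by apply: eq_sw => p q; rewrite !rhoM !mulmxA.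
rewrite (casimir_eq R) (weight_scalar R hk sqrtP) !mul_mx_scalar mxtraceZ.
by rewrite linearZ scalerA.
Qed.

Lemma central_expansion z : central z ->
  z = \sum_i ((chi i z : k) / d i) *: F i.
Proof.
move=> zC; apply: (rho_inj R) => j.
have [a aE] : exists a, rho j z = a%:M.
  by apply: schur_eq => h; rewrite -!rhoM zC.
rewrite linear_sum (bigD1 j) //= big1 ?addr0 => [|i /negPf ij]; last first.
  by rewrite linearZ /= rho_central_unit eq_sym ij scaler0.
rewrite linearZ /= rho_central_unit eqxx scalemx1 /chi aE mxtrace_scalar.
by rewrite -mulr_natr mulfK ?d_neq0.
Qed.

Lemma brace_central z : central z -> central (brace z L).
Proof.
move=> zC h; apply: (rho_inj R) => i.
rewrite !rhoM rho_brace -scalemxAl -scalemxAr -!rhoM.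
by rewrite partial_trace_central.
Qed.

Lemma brace_expansion z : central z ->
  brace z L = \sum_i ((ad_char i z : k) / d i ^+ 2) *: F i.
Proof.
move=> zC; rewrite [LHS]central_expansion; last exact: brace_central.
apply: eq_bigr => i _; congr (_ *: _).
rewrite {1}/chi rho_brace mxtraceZ.
have -> : \tr (rho i (sw (fun a b => (chi i (S b) : k) *: a) z)) = ad_char i z.
  rewrite (@sw_lin_scalar _ _ _ (fun x => \tr (rho i x) : k^o)); try lin.
  by apply: eq_sw_scalar => a b; rewrite linearZ mxtraceZ mulrC.
by rewrite expr2 invfM mulrA [_^-1 * _]mulrC.
Qed.

End AdjointCharacters.

Arguments central_unit {k H} L {n m} rho i.
Arguments ad_char {k H n m} rho i h.

(** * The matrix of the operator *)
Lemma closed_sqrt (k : closedFieldType) (a : k) : exists c, c ^+ 2 = a.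
Proof.
have [c] : exists c, root ('X^2 - a%:P) c.
  by apply/closed_rootP; rewrite size_XnsubC.
by rewrite /root !hornerE subr_eq0 => /eqP ca; exists c.
Qed.

Theorem proposition2p1
  (k : closedFieldType) (hk : [pchar k] =i pred0)
  (H : hopfAlgType k) (ssH : semisimple H)
  (L : H) (hL : idempotent_integral L)
  (n : nat) (V : 'I_n.+1 -> hmodule H) (hV : complete_irreducibles V)
  (hV0 : character (V ord0) = linfun (@counit k H))
  (E : 'I_n.+1 -> H) (hE : forall i, associated_idempotent (V i) (E i)) :
  let d (i : 'I_n.+1) : k := (\dim {:V i})%:R in
  let chi (i : 'I_n.+1) := character (V i) in
  let s := @dual_antipode k H in
  let T (z : H) := brace z L in
  let e := [tuple (d i) ^- 2 *: E i | i < n.+1] in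
  let A : 'M[k]_n.+1 := \matrix_(i, j)
    (dual_mul (dual_mul (chi i) (s (chi i))) (s (chi j)) L / d j) in
  [/\ (* (i) *)
      [/\ basis_of 'Z({:H})%VS e,
          forall z, z \in 'Z({:H})%VS -> T z \in 'Z({:H})%VS
        & matrix_of_operator T e A],
      (* (ii) *)
      (forall i j, nonneg_rational (A i j)) /\ (forall i, A i ord0 = 1),
      (* (iii) *)
      forall (m : nat) j, (A ^+ m) ord0 j = (j == ord0)%:R
    & (* (iv) *)
      forall (m : nat) i, (0 < m)%N ->
        (A ^+ m) i ord0 = \sum_j (A ^+ m.-1) i j
        /\ pos_rational ((A ^+ m) i ord0)].
Proof.
set m := fun i => \dim {:V i}.
pose rho i : {linear H -> 'M[k]_(m i)} := mxrep (V i).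
have R : split_system L rho := mxrep_system hk ssH hL hV hV0.
have sqrtP := @closed_sqrt k.
move=> d chi s T e A; have /pcharf0P ch := hk.
have d_neq0 i : d i != 0 by rewrite /d ch -lt0n (sys_dim R).
have chiE i h : chi i h = \tr (rho i h) by exact: characterE.
pose F := central_unit L rho.
have rhoF i j : rho j (F i) = if j == i then 1%:M else 0.
  exact: rho_central_unit.
have rhoZ j c x : rho j (c *: x) = c *: rho j x by exact: linearZ.
have centralP z : reflect (central z) (z \in 'Z({:H})%VS).
  rewrite memv_cap memvf /=; apply: (iffP centvP) => [zC h|zC h _].
    by rewrite zC ?memvf.
  by rewrite zC.
have FC i : central (F i).
  move=> h; apply: (rho_inj R) => j; rewrite !(sys_mul R) rhoF.
  by case: ifP => _; rewrite ?mulmx1 ?mul1mx // mulmx0 mul0mx.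
have FF i : F i * F i = F i.
  apply: (rho_inj R) => j; rewrite (sys_mul R) rhoF.
  by case: ifP => _; rewrite ?mulmx1 // mulmx0.
(* [E i] and [F i] both act as the identity on [V i]; primitivity forces the
   part of [E i] outside the block of [F i] to vanish. *)
have EF i : E i = F i.
  have [[[/centralP EC EE] E0 prim] actE] := hE i.
  have rhoE : rho i (E i) = 1%:M by exact: mxrep_id.
  have fC : central (E i * F i)
    by move=> h; rewrite mulrA (EC h) -mulrA (FC i h) mulrA.
  have fE : E i * F i * E i = E i * F i by rewrite (EC (E i * F i)) mulrA EE.
  have fI : E i * F i * (E i * F i) = E i * F i by rewrite mulrA fE -mulrA FF.
  have [||||f0|g0] := prim (E i * F i) (E i - E i * F i).
  - by split=> //; apply/centralP.
  - split; last by rewrite mulrBl !mulrBr EE fI fE mulrA EE subrr subr0.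
    by apply/centralP => h; rewrite mulrBr mulrBl EC fC.
  - by rewrite mulrBr fE fI subrr.
  - by rewrite addrC subrK.
  - have := congr1 (rho i) f0; rewrite (sys_mul R) rhoE rhoF eqxx mulmx1
    linear0.
    move/matrixP/(_ (Ordinal (sys_dim R i)) (Ordinal (sys_dim R i))).
    by rewrite !mxE eqxx => /eqP; rewrite oner_eq0.
  move/eqP: g0; rewrite subr_eq0 => /eqP EEF.
  apply: (rho_inj R) => j; rewrite EEF (sys_mul R) rhoF.
  by case: eqP => [->|_]; rewrite ?mulmx0 // rhoE mulmx1.
have Eex z : central z -> z = \sum_i ((chi i z : k) / d i) *: E i.
  move=> zC; rewrite [LHS](central_expansion R hk sqrtP zC).
  by apply: eq_bigr => i _; rewrite chiE EF.
pose f i := ad_char rho i.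
have dual_mulE g1 g2 h : dual_mul g1 g2 h = sw (fun a b => g1 a * g2 b : k^o) h.
  by rewrite lfunE.
have sE g h : s g h = g (@antipode k H h) by rewrite comp_lfunE lfunE.
(* [E j] is [d j *: L_1 chi_j (S L_2)], so the character product evaluated at
   [L] is the adjoint character evaluated at [E j], up to [d j]. *)
have AE i j : A i j = (f i (F j) : k) / d j ^+ 2.
  have fE : f i (F j) = d j * (A i j * d j) :> k.
    rewrite mxE divfK // /f ad_central_unit; congr (_ * _).
    rewrite dual_mulE; apply: eq_sw_scalar => a b; congr (_ * _).
      rewrite dual_mulE; apply: eq_sw_scalar => x y; rewrite sE !chiE //.
    by rewrite sE chiE.
  by rewrite fE mulrCA -expr2 mulfK // expf_neq0.
have d0 : d ord0 = 1.
  have := chiE ord0 1; rewrite /chi hV0 lfunE /= counit1 (sys_one R) mxtrace1.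
  by move->.
have F0 : F ord0 = L.
  apply: (rho_inj R) => j; rewrite rhoF; case: eqP => [->|/eqP j0].
    by rewrite (sys_trivial R) (sys_epsL R).
  by rewrite (rho_int R).
have A0 i : A i ord0 = 1.
  by rewrite AE d0 F0 /f (ad_int R) expr1n divr1.
have Ann i j : nonneg_rational (A i j).
  have [r rE] := ad_nat R hk sqrtP i j.
  rewrite AE /f rE /d -natrX; exact: nonneg_rational_nat_div.
have A0j j : A ord0 j = (j == ord0)%:R.
  have epsE h : (@counit k H h : k) = \tr (rho ord0 h).
    by rewrite -chiE /chi hV0 lfunE.
  rewrite AE /f (ad_trivial R) epsE rhoF eq_sym.
  case: eqP => [->|_]; last by rewrite mxtrace0 mul0r.
  by rewrite mxtrace1 -/(d ord0) d0 expr1n divr1.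
have pow0 p j : (A ^+ p) ord0 j = (j == ord0)%:R.
  elim: p j => [|p IHp] j; first by rewrite expr0 mxE eq_sym.
  rewrite exprS mxE (bigD1 ord0) //= big1 ?addr0 => [|l /negPf l0].
    by rewrite A0j eqxx mul1r.
  by rewrite A0j l0 mul0r.
split.
- split.
  + have eE i : tnth e i = d i ^- 2 *: E i by rewrite tnth_mktuple.
    apply/andP; split.
      rewrite eqEsubv; apply/andP; split.
        apply/span_subvP => _ /tnthP[i ->]; rewrite eE EF memvZ //.
        exact/centralP.
      apply/subvP => z /centralP/Eex ->; apply: memv_suml => i _.
      have -> : E i = d i ^+ 2 *: tnth e i.
        by rewrite eE scalerA mulfV ?scale1r // expf_neq0.
      by rewrite !memvZ // memv_span // mem_tnth.
    apply/freeP => c c0 j; have {c0} : \sum_i c i *: tnth e i = 0.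
      by rewrite -[RHS]c0; apply: eq_bigr => i _; rewrite (tnth_nth 0).
    move/(congr1 (rho j)).
    rewrite linear_sum linear0 (bigD1 j) //= big1 ?addr0 => [|i /negPf ij].
      rewrite eE EF 2!rhoZ rhoF eqxx scalerA scalemx1.
      move/matrixP/(_ (Ordinal (sys_dim R j)) (Ordinal (sys_dim R j))).
      rewrite !mxE eqxx mulr1n => /eqP; rewrite mulf_eq0 invr_eq0.
      by rewrite expf_eq0 (negPf (d_neq0 j)) orbF => /eqP.
    by rewrite eE EF 2!rhoZ rhoF eq_sym ij !scaler0.
  + by move=> z /centralP zC; apply/centralP/(brace_central R hk sqrtP).
  + move=> j; rewrite tnth_mktuple.
    have zC : central (d j ^- 2 *: E j).
      by move=> h; rewrite -scalerAr -scalerAl EF FC.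
    rewrite /T (brace_expansion R hk sqrtP zC); apply: eq_bigr => i _.
    rewrite tnth_mktuple [RHS]scalerA !EF AE (linZ _ _ (@lin_ad_char _ _ _ _
      rho i)).
    by congr (_ *: _); congr (_ * _); apply: mulrC.
- by [].
- exact: pow0.
- move=> [//|p] i _ /=; split.
    by rewrite exprSr mxE; apply: eq_bigr => j _; rewrite A0 mulr1.
  (* The term of index 0 is [A i 0 * (A ^+ p) 0 0 = 1]. *)
  rewrite exprS mxE (bigD1 ord0) //= A0 pow0 eqxx mulr1.
  apply: pos_rational_1D => //; apply: nonneg_rational_sum => // j _.
  by apply: nonneg_rationalM => //; apply: nonneg_rational_mxpow.
Qed.
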